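(* Assume that the process $X$ on $(\Omega,\mathcal{F},\mathbb{P})$ has the FOED property with function of evolution of distribution $F$, and that its initial distribution has a strictly positive density. The following statements are equivalent: (i) For each $\mathcal{F}^X_\infty$-measurable positive or bounded random variable $Z$, each $t>0$ and all $x,y\in E$, $$\mathbb{E}(Z\circ\theta_t)=\mathbb{E}\big(Z\,e^{\int_0^tF(u,X_0)du}\big),\qquad \mathbb{E}(Z\circ\theta_t\,|\,X_t=x,\,X_0=y)=\mathbb{E}(Z\circ\theta_t\,|\,X_t=x).$$ (ii) $X$ is a (time-homogeneous) Markov process with respect to $\mathbb{F}^X$.
   Context: Setting: $(\Omega,\mathcal{F},\mathbb{P})$ is a complete probability space; $X=(X_t)_{t\ge0}$ is a càdlàg process with values in a Polish space $(E,\mathcal{E})$ (typically $E\subset\mathbb{R}^d$), with non-atomic initial distribution; densities are with respect to the Lebesgue measure. $\mathbb{F}^X=(\mathcal{F}^X_t)_{t\ge0}$ is the filtration generated by $X$, augmented to satisfy the usual conditions. The shift operators $\theta_t$ are assumed well defined, so $X_s\circ\theta_t=X_{t+s}$. For $x\in E$, $\mathbb{P}_x(A)=\mathbb{P}(A\,|\,X_0=x)$, $A\in\mathcal{F}$, in the sense of regular conditional probabilities, and $\mathbb{E}_x$ is the corresponding expectation. $X$ is a time-homogeneous Markov process with respect to $\mathbb{F}^X$ if $\mathbb{P}(X_t\in A\,|\,\mathcal{F}^X_s)=\mathbb{P}_{X_s}(X_{t-s}\in A)$ $\mathbb{P}$-a.s. for all $0\le s\le t$ and $A\in\mathcal{E}$.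 FOED property: $X$ has the FOED property if there is a Borel measurable $F:\mathbb{R}_+\times E\to\mathbb{R}$ such that for every $y\in E$ the function $u\mapsto F(u,y)$ is locally integrable and $\mathbb{E}f(X_t)=\mathbb{E}\big(f(X_0)e^{\int_0^tF(u,X_0)du}\big)$ for every bounded Borel function $f$ on $E$ and every $t\ge0$. Such an $F$ is called the function of evolution of distribution of $X$. Identities between functions defined through conditional expectations given values of $X$ are understood in the usual almost-sure sense. *)

(* Defs.v *)
From HB Require Import structures.
From mathcomp Require Import all_boot all_order all_algebra.
From mathcomp Require Import all_classical all_reals all_analysis.
From mathcomp Require Import measurable_realfun.

Set Implicit Arguments.
Unset Strict Implicit.
Unset Printing Implicit Defensive.

Import Order.TTheory GRing.Theory Num.Theory.
Import numFieldNormedType.Exports.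

Local Open Scope classical_set_scope.
Local Open Scope ring_scope.

Notation borel T := (g_sigma_algebraType (@open T)).

Section state_space.
Variable R : realType.

Definition polish (T : topologicalType) : Prop :=
  (exists D : set T, countable D /\ dense D) /\
  exists dist : T -> T -> R,
    [/\ [/\ forall x y, 0 <= dist x y,
            forall x y, dist x y = 0 <-> x = y,
            forall x y, dist x y = dist y x &
            forall x y z, dist x z <= dist x y + dist y z],
        forall (x : T) (A : set T),
          nbhs x A <-> exists2 e, 0 < e & [set y | dist x y < e] `<=` A &
        forall u : nat -> T,
          (forall e, 0 < e -> exists N, forall m n,
             (N <= m)%N -> (N <= n)%N -> dist (u m) (u n) < e) ->
          exists l : T, u @ \oo --> l].

Definition topological_embedding (S T : topologicalType) (f : S -> T) : Prop :=
  injective f /\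
  forall U : set S, open U <-> exists2 V : set T, open V & U = f @^-1` V.

(* Lebesgue measure on the Borel sets of R^d, built one coordinate at a time;
   for d = 0 it is the unit mass at the only point. *)
Fixpoint lebesgue_rV (d : nat) : set (borel 'rV[R]_d) -> \bar R :=
  match d with
  | 0%N => fun A => @dirac _ (borel 'rV[R]_0) (0 : 'rV[R]_0) R A
  | d'.+1 => fun A =>
      (lebesgue_measure \x lebesgue_rV (d := d'))%E
        [set p : R * borel 'rV[R]_d' |
          A (row_mx (const_mx p.1 : 'rV[R]_1) (p.2 : 'rV[R]_d'))]
  end.

End state_space.

Section conditioning.
Context {R : realType} {dO : measure_display} {Omega : measurableType dO}.
Variable P : probability Omega R.

Definition measurable_wrt (dS : measure_display) (S : measurableType dS)
    (G : set (set Omega)) (V : Omega -> S) : Prop :=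
  forall B : set S, measurable B -> G (V @^-1` B).

(* [V] is a version of E(W | G).  It is used with [W] nonnegative or bounded;
   versions are then unique up to a P-null set. *)
Definition is_cond_exp (G : set (set Omega)) (W V : Omega -> \bar R) : Prop :=
  measurable_wrt G V /\
  forall A, G A -> (\int[P]_(w in A) V w = \int[P]_(w in A) W w)%E.

(* [h] is a version of the function y |-> E(W | Y = y). *)
Definition is_cond_exp_given (dS : measure_display) (S : measurableType dS)
    (Y : Omega -> S) (W : Omega -> \bar R) (h : S -> \bar R) : Prop :=
  measurable_fun [set: S] h /\
  is_cond_exp (preimage_set_system setT Y measurable) W (h \o Y).

Definition atomless (dS : measure_display) (S : measurableType dS)
    (mu : set S -> \bar R) : Prop :=
  forall A, measurable A -> (0 < mu A)%E ->
  exists B, [/\ measurable B, B `<=` A & (0 < mu B < mu A)%E].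

End conditioning.

Section process.
Context {R : realType} {dO : measure_display} {Omega : measurableType dO}.
Variable P : probability Omega R.
Context {E : ptopologicalType}.
(* Only the values [X t] with 0 <= t matter. *)
Variable X : R -> Omega -> E.

Definition cadlag : Prop := forall w : Omega,
  (forall t, 0 <= t -> X s w @[s --> t^'+] --> X t w) /\
  (forall t, 0 < t -> exists l : E, X s w @[s --> t^'-] --> l).

Definition shift_operators (theta : R -> Omega -> Omega) : Prop :=
  forall s t w, 0 <= s -> 0 <= t -> X s (theta t w) = X (t + s) w.

(* sigma(X_t, t in I), before augmentation. *)
Definition sigma_gen (I : set R) : set (set Omega) :=
  <<s \bigcup_(t in I)
        preimage_set_system setT (X t : Omega -> borel E) measurable >>.

(* Following the usual definition of the augmentation of the filtration of a
   process, the null sets are the subsets of null sets of sigma(X_t, t >= 0),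
   not arbitrary null sets of the ambient sigma-algebra: the shifts need not
   preserve the latter. *)
Definition null_sets : set (set Omega) :=
  [set N | exists A, [/\ sigma_gen `[0, +oo[ A, P A = 0%E & N `<=` A]].

Definition filtration (t : R) : set (set Omega) :=
  \bigcap_(s in `]t, +oo[) <<s sigma_gen `[0, s] `|` null_sets >>.

Definition filtration_oo : set (set Omega) :=
  <<s \bigcup_(t in `[0, +oo[) filtration t >>.

(* The family (P_x)_x is a kernel on sigma(X_t, t >= 0): on the completed
   sigma-algebra, regular conditional probabilities do not exist in general. *)
Definition regular_cond_prob
    (Px : R.-pker (borel E) ~> g_sigma_algebraType (sigma_gen `[0, +oo[)) :
    Prop :=
  forall A : set Omega, sigma_gen `[0, +oo[ A ->
  is_cond_exp_given P (X 0 : Omega -> borel E)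
    (fun w => (\1_A w)%:E) (fun x => Px x A).

Definition markov_process
    (Px : R.-pker (borel E) ~> g_sigma_algebraType (sigma_gen `[0, +oo[)) :
    Prop :=
  forall s t, 0 <= s -> s <= t -> forall A : set (borel E), measurable A ->
  is_cond_exp P (filtration s) (fun w => (\1_(X t @^-1` A) w)%:E)
    (fun w => Px (X s w) (X (t - s) @^-1` A)).

Definition exp_evolution (F : R -> E -> R) (t : R) (y : E) : R :=
  expR (\int[lebesgue_measure]_(u in `[0, t]) F u y).

Definition FOED (F : R -> E -> R) : Prop :=
  [/\ measurable_fun [set uy : R * borel E | 0 <= uy.1]
        (fun uy : R * borel E => F uy.1 uy.2),
      forall (y : E) (t : R), 0 <= t ->
        lebesgue_measure.-integrable `[0, t] (fun u : R => (F u y)%:E) &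
      forall f : borel E -> R, measurable_fun setT f ->
        (exists M, forall x, `|f x| <= M) ->
        forall t, 0 <= t ->
        ('E_P[fun w => f (X t w)] =
         'E_P[fun w => (f (X 0 w) * exp_evolution F t (X 0 w))%R])%E].

(* [iota] identifies the state space with a subset of R^d. *)
Definition has_positive_density (d : nat) (iota : E -> 'rV[R]_d) : Prop :=
  exists p : borel 'rV[R]_d -> R,
    [/\ measurable_fun setT p,
        forall x : E, 0 < p (iota x) &
        forall B : set (borel 'rV[R]_d), measurable B ->
          (P [set w | B (iota (X 0 w))] =
           \int[@lebesgue_rV R d]_(x in B `&` range iota) (p x)%:E)%E].

(* The identity between conditional expectations given values of X is between
   arbitrary versions, almost everywhere for the law of (X_t, X_0); versions
   exist because Z o theta_t is nonnegative or bounded. *)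
Definition shift_property (theta : R -> Omega -> Omega) (F : R -> E -> R) :
    Prop :=
  forall Z : Omega -> R, measurable_wrt filtration_oo Z ->
  (forall w, 0 <= Z w) \/ (exists M, forall w, `|Z w| <= M) ->
  forall t, 0 < t ->
  ('E_P[fun w => Z (theta t w)] =
   'E_P[fun w => (Z w * exp_evolution F t (X 0 w))%R])%E /\
  forall (g : borel E * borel E -> \bar R) (h : borel E -> \bar R),
    is_cond_exp_given P
      (fun w => (X t w, X 0 w) : (borel E * borel E)%type)
      (fun w => (Z (theta t w))%:E) g ->
    is_cond_exp_given P (X t : Omega -> borel E)
      (fun w => (Z (theta t w))%:E) h ->
    {ae pushforward P (fun w => (X t w, X 0 w) : (borel E * borel E)%type),
      forall xy, g xy = h xy.1}.

End process.

Arguments regular_cond_prob {R dO Omega} P {E} X Px.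
Arguments markov_process {R dO Omega} P {E} X Px.

(* Main.v *)
Require Import Defs.
From HB Require Import structures.
From mathcomp Require Import all_boot all_order all_algebra.
From mathcomp Require Import all_classical all_reals all_analysis.
From mathcomp Require Import measurable_realfun.
From mathcomp Require Import lra.

Import Order.TTheory GRing.Theory Num.Theory.
Import numFieldNormedType.Exports.

Local Open Scope classical_set_scope.
Local Open Scope ring_scope.

(* Write e_t(x) = exp(int_0^t F(u, x) du). The FOED property says that the law of
   X_t has density e_t with respect to the law of X_0.

   From the shift property: the first identity gives E(Z o theta_t | X_t) =
   E_{X_t}(Z), the second one adds the conditioning on X_0. Any event A with
   P(A, X_t in b) = E(rho(X_0); X_0 in b) and the Markov property at t then
   satisfies P(A, theta_t^-1 B) = E(rho(X_0); B), which replaces the process after t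
   by the process started from a reweighted initial law. This allows an induction
   on the number of times of a cylinder of the past, and a pi-system argument gives
   the Markov property for the raw past. Passing to the right-continuous augmented
   filtration uses that X_{s+1/n} -> X_s pointwise and that the laws converge
   setwise, so that P(X_s in C, X_{s+1/n} notin C) -> 0 for every Borel set C.

   From the Markov property: an induction on the times of a cylinder of the future
   extends it to all events of the future. The first identity follows by FOED. The
   second one is conditional independence of past and future given X_t; measurable
   functions on the augmented sigma-algebra are first modified on a null set, whose
   shifts are null by the first identity. *)

(** * Transport of integrals *)

Section integral_transport.
Context {R : realType} {d1 d2 dS : measure_display}.
Context {T1 : measurableType d1} {T2 : measurableType d2}.
Context {S : measurableType dS}.
Local Open Scope ereal_scope.

(** Multiplication by [+oo] is discontinuous at 0, so convergence alone would not suffice. A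
    nonnegative nondecreasing sequence is either identically 0 or eventually positive, and both
    cases are harmless. *)
Lemma nondecreasing_cvgeMr (a : (\bar R)^nat) (l u : \bar R) :
  nondecreasing_seq a -> (forall n, 0 <= a n) -> a @ \oo --> l -> 0 <= u ->
  (fun n => a n * u) @ \oo --> l * u.
Proof.
move=> nda a0 al u0; case: u u0 => [r _|_|//]; first exact: cvgeZr.
have al_ub n : a n <= l.
  rewrite -(cvg_lim (@ereal_hausdorff R) al).
  rewrite (cvg_lim _ (ereal_nondecreasing_cvgn nda))//.
  by apply: ereal_sup_ubound; exists n.
have [[N aN]|/forallNP aN] := pselect (exists N, 0 < a N).
  rewrite gt0_muley; last exact: lt_le_trans aN (al_ub N).
  apply: cvg_near_cst; exists N => // n /= Nn.
  by rewrite gt0_muley// (lt_le_trans aN)// nda.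
have a_eq0 : a = cst 0.
  apply/funext => n; apply/eqP; rewrite eq_le a0 andbT leNgt; apply/negP.
  exact: aN.
rewrite a_eq0 in al *; rewrite -(cvg_lim (@ereal_hausdorff R) al) lim_cst//.
by apply: cvg_near_cst; apply: nearW => n; rewrite !mul0e.
Qed.

Import HBNNSimple.

(** Splitting along the level sets of [h] leaves [Y] visible only through the integrals of [W] over
    the events that [Y] lies in a given set. Equality of two such set functions is all that the
    transport needs. *)
Lemma integral_comp_nnsfun d (T : measurableType d)
    (m : {measure set T -> \bar R}) D W (Y : T -> S) (h : {nnsfun S >-> R}) :
  measurable D -> measurable_fun setT W -> (forall x, 0 <= W x) ->
  measurable_fun setT Y ->
  \int[m]_(x in D) ((h (Y x))%:E * W x) = \sum_(r \in range h)
    (r%:E * \int[m]_(x in D `&` Y @^-1` (h @^-1` [set r])) W x).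
Proof.
move=> mD mW W0 mY.
have mYr r : measurable (Y @^-1` (h @^-1` [set r])).
  by rewrite -[X in measurable X]setTI; apply: mY.
have mWr r : measurable_fun D (W \_ (Y @^-1` (h @^-1` [set r]))).
  by apply/measurable_funTS/(measurable_restrictT _ _).1 => //;
    exact: measurable_funTS.
transitivity (\int[m]_(x in D) (\sum_(r \in range h)
    (r%:E * (W \_ (Y @^-1` (h @^-1` [set r]))) x))).
  apply: eq_integral => x _.
  rewrite [in LHS](fimfunE h) -fsumEFin// ge0_mule_fsuml; last first.
    by move=> r; exact: nnfun_muleindic_ge0.
  apply: eq_fsbigr => r _; rewrite EFinM -muleA; congr (_ * _).
  by rewrite epatch_indic muleC.
rewrite ge0_integral_fsum//; last 2 first.
- by move=> r; apply: measurable_funeM.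
(* Nonnegativity is required for every real [r]; a negative one has an empty level set, since [h] is
   nonnegative. *)
- move=> r x _; have [r0|r0] := leP 0%R r.
    by rewrite mule_ge0 ?lee_fin// erestrict_ge0.
  rewrite (_ : h @^-1` [set r] = set0) ?preimage_set0 ?patch_set0 ?mule0//.
  by apply: preimage_nnfun0.
apply: eq_fsbigr => r; rewrite inE => -[y _ <-].
rewrite ge0_integralZl//; last 2 first.
- by move=> x _; rewrite erestrict_ge0.
- by rewrite lee_fin.
by rewrite -integral_mkcondr.
Qed.

Lemma cvg_integral_comp_approx d (T : measurableType d)
    (m : {measure set T -> \bar R}) D W (Y : T -> S) (psi : S -> \bar R)
    (mpsi : measurable_fun setT psi) :
  measurable D -> measurable_fun setT W -> (forall x, 0 <= W x) ->
  measurable_fun setT Y -> (forall y, 0 <= psi y) ->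
  \int[m]_(x in D) ((nnsfun_approx measurableT mpsi n (Y x))%:E * W x) @[n -->
    \oo] -->
  \int[m]_(x in D) (psi (Y x) * W x).
Proof.
move=> mD mW W0 mY psi0.
have lim_psi x : psi (Y x) * W x =
    limn (fun n => (nnsfun_approx measurableT mpsi n (Y x))%:E * W x).
  apply/esym/cvg_lim => //; apply: nondecreasing_cvgeMr => //.
  - by move=> a b ab; rewrite lee_fin; exact/lefP/nd_nnsfun_approx.
  - by move=> n; rewrite lee_fin.
  - by apply: (cvg_nnsfun_approx measurableT mpsi).
under [X in _ --> X]eq_integral do rewrite lim_psi.
apply: cvg_monotone_convergence => //.
- move=> n; apply: emeasurable_funM; last exact: measurable_funTS.
  apply/measurable_EFinP/measurable_funTS.
  exact: measurableT_comp.
- by move=> n x _; rewrite mule_ge0// lee_fin.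
- move=> x _ a b ab; rewrite lee_wpmul2r// lee_fin.
  exact/lefP/nd_nnsfun_approx.
Qed.

Variables (mu : {measure set T1 -> \bar R}) (nu : {measure set T2 -> \bar R}).
Variables (D1 : set T1) (D2 : set T2).
Hypotheses (mD1 : measurable D1) (mD2 : measurable D2).
Variables (U : T1 -> \bar R) (V : T2 -> \bar R).
Hypotheses (mU : measurable_fun setT U) (mV : measurable_fun setT V).
Hypotheses (U0 : forall x, 0 <= U x) (V0 : forall x, 0 <= V x).

(** The two sides agree on simple functions by their level sets, and monotone convergence does the
    rest. Nonnegative extended functions avoid every integrability condition. *)
Lemma eq_integral_comp (Y1 : T1 -> S) (Y2 : T2 -> S) (psi : S -> \bar R) :
  measurable_fun setT Y1 -> measurable_fun setT Y2 ->
  measurable_fun setT psi -> (forall y, 0 <= psi y) ->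
  (forall b, measurable b ->
    \int[mu]_(x in D1 `&` Y1 @^-1` b) U x =
    \int[nu]_(x in D2 `&` Y2 @^-1` b) V x) ->
  \int[mu]_(x in D1) (psi (Y1 x) * U x) =
  \int[nu]_(x in D2) (psi (Y2 x) * V x).
Proof.
move=> mY1 mY2 mpsi psi0 UV.
have cvgU := @cvg_integral_comp_approx _ _ mu D1 U Y1 psi mpsi mD1 mU U0 mY1
  psi0.
have cvgV := @cvg_integral_comp_approx _ _ nu D2 V Y2 psi mpsi mD2 mV V0 mY2
  psi0.
rewrite -(cvg_lim (@ereal_hausdorff R) cvgU) -(cvg_lim (@ereal_hausdorff R)
  cvgV).
congr (limn _); apply/funext => n; rewrite !integral_comp_nnsfun//.
apply: eq_fsbigr => r _; rewrite UV//.
Qed.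

End integral_transport.

Section integral_pi_system.
Context {R : realType} {d1 d2 : measure_display}.
Context {T1 : measurableType d1} {T2 : measurableType d2}.
Context {S : pointedType} (C : set (set S)).
Local Open Scope ereal_scope.
Variables (mu : {measure set T1 -> \bar R}) (nu : {measure set T2 -> \bar R}).
Variables (D1 : set T1) (D2 : set T2).
Hypotheses (mD1 : measurable D1) (mD2 : measurable D2).
Variables (U : T1 -> \bar R) (V : T2 -> \bar R).
Hypotheses (mU : measurable_fun setT U) (mV : measurable_fun setT V).
Hypotheses (U0 : forall x, 0 <= U x) (V0 : forall x, 0 <= V x).
Hypothesis (Uoo : \int[mu]_(x in D1) U x < +oo).
Hypotheses (CI : setI_closed C) (CT : C setT).

(** Dynkin's argument for two set functions of [b]. The finite total mass [Uoo] is what allows the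
    subtraction for complements. *)
Lemma eq_integral_pi_system (Y1 : T1 -> g_sigma_algebraType C)
    (Y2 : T2 -> g_sigma_algebraType C) :
  measurable_fun setT Y1 -> measurable_fun setT Y2 ->
  (forall b, C b ->
    \int[mu]_(x in D1 `&` Y1 @^-1` b) U x =
    \int[nu]_(x in D2 `&` Y2 @^-1` b) V x) ->
  forall b, <<s C >> b ->
    \int[mu]_(x in D1 `&` Y1 @^-1` b) U x =
    \int[nu]_(x in D2 `&` Y2 @^-1` b) V x.
Proof.
move=> mY1 mY2 UV.
have intC d (T : measurableType d) (m : {measure set T -> \bar R}) D W
    (Y : T -> g_sigma_algebraType C) (A : set (g_sigma_algebraType C)) :
    measurable D -> measurable_fun setT W -> (forall x, 0 <= W x) ->
    measurable_fun setT Y -> measurable A ->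
    \int[m]_(x in D) W x = \int[m]_(x in D `&` Y @^-1` A) W x +
      \int[m]_(x in D `&` Y @^-1` (~` A)) W x.
  move=> mD mW W0 mY mA.
  have mYA B : measurable B -> measurable (Y @^-1` B).
    by move=> mB; rewrite -[X in measurable X]setTI; apply: mY.
  rewrite -ge0_integral_setU//; first last.
  - by rewrite disj_set2E setIACA preimage_setC setICr setI0.
  - exact: measurable_funTS.
  - by apply: measurableI => //; apply/mYA/measurableC.
  - by apply: measurableI => //; exact: mYA.
  by rewrite -setIUr preimage_setC setUCr setIT.
have mYA d (T : measurableType d) (Y : T -> g_sigma_algebraType C)
    (A : set (g_sigma_algebraType C)) :
  measurable_fun setT Y -> measurable A -> measurable (Y @^-1` A).
  by move=> mY mA; rewrite -[X in measurable X]setTI; apply: mY.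
apply: (@dynkin_induction _ (g_sigma_algebraType C) C) => //.
- exact: UV.
- move=> A mA UVA.
  have := UV _ CT; rewrite !preimage_setT !setIT.
  rewrite (intC _ _ mu D1 U Y1 A)// (intC _ _ nu D2 V Y2 A)// UVA.
  have UVAfin : \int[nu]_(x in D2 `&` Y2 @^-1` A) V x \is a fin_num.
    rewrite -UVA ge0_fin_numE ?integral_ge0//.
    apply: le_lt_trans Uoo; apply: ge0_subset_integral => //.
    + by apply: measurableI => //; exact: mYA.
    + exact: measurable_funTS.
  rewrite addeC [in RHS]addeC.
  by move=> /(congr1 (fun x => x - \int[nu]_(x in D2 `&` Y2 @^-1` A) V x));
    rewrite !addeK.
- move=> F mF tF UVF.
  have trivIset_preimage d (T : measurableType d) (Y : T -> S) :
      trivIset [set: nat] (fun n => Y @^-1` F n).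
    move=> i j _ _ [x [Fi Fj]]; apply: tF => //; by exists (Y x).
  rewrite !preimage_bigcup !setI_bigcupr.
  rewrite !ge0_integral_bigcup//.
  + by apply: eq_eseriesr => n _; exact: UVF.
  + by move=> n; apply: measurableI => //; exact: mYA.
  + exact: measurable_funTS.
  + by apply: trivIset_setIl; exact: trivIset_preimage.
  + by move=> n; apply: measurableI => //; exact: mYA.
  + exact: measurable_funTS.
  + by apply: trivIset_setIl; exact: trivIset_preimage.
Qed.

End integral_pi_system.

(** * Conditional densities and uniqueness of versions *)

Section density.
Context {R : realType} {dT dS : measure_display}.
Context {T : measurableType dT} {S : measurableType dS}.
Variable P : probability T R.
Local Open Scope ereal_scope.
Variables (Y : T -> S) (A : set T).
Hypotheses (mY : measurable_fun setT Y) (mA : measurable A).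

Let measurable_preimage b : measurable b -> measurable (Y @^-1` b).
Proof. by move=> mb; rewrite -[X in measurable X]setTI; apply: mY. Qed.

Definition restricted_law (b : set S) := P (A `&` Y @^-1` b).

Let law0 : restricted_law set0 = 0.
Proof. by rewrite /restricted_law preimage_set0 setI0 measure0. Qed.

Let law_ge0 b : 0 <= restricted_law b. Proof. exact: measure_ge0. Qed.

Let law_additive : semi_sigma_additive restricted_law.
Proof.
move=> F mF tF mUF; rewrite /restricted_law preimage_bigcup setI_bigcupr.
apply: measure_semi_sigma_additive.
- by move=> n; apply: measurableI => //; exact: measurable_preimage.
- by move=> i j _ _ [x [[_ Fi] [_ Fj]]]; apply: tF => //; exists (Y x).
- rewrite -setI_bigcupr -preimage_bigcup.
  by apply: measurableI => //; exact: measurable_preimage.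
Qed.

HB.instance Definition _ := isMeasure.Build _ _ _ restricted_law law0 law_ge0
  law_additive.

Let law_fin : fin_num_fun restricted_law.
Proof.
move=> b mb; apply: fin_num_measure.
by apply: measurableI => //; exact: measurable_preimage.
Qed.

HB.instance Definition _ := Measure_isFinite.Build _ _ _ restricted_law law_fin.

(** [psi] is a version of P(A | Y = y): the Radon-Nikodym derivative of [restricted_law], which the
    law of [Y] dominates. *)
Lemma density_along :
  exists psi : S -> \bar R,
    [/\ measurable_fun setT psi, forall y, 0 <= psi y &
        forall b, measurable b ->
          P (A `&` Y @^-1` b) = \int[P]_(w in Y @^-1` b) psi (Y w)].
Proof.
pose mu : {finite_measure set S -> \bar R} :=
  distribution P (HB.pack_for {mfun T >->
    S} Y (isMeasurableFun.Build _ _ _ _ _ mY)).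
have [|psi [psi0 /measurable_int mpsi psiE]] :=
  @radon_nikodym_finite _ _ _ mu restricted_law.
  apply/null_content_dominatesP => b mb Yb0; apply/eqP.
  rewrite -measure_le0 -Yb0; apply: le_measure; rewrite ?inE.
  - by apply: measurableI => //; exact: measurable_preimage.
  - exact: measurable_preimage.
  - exact: subIsetr.
exists psi; split => // b mb.
by rewrite -/(restricted_law b) psiE// ge0_integral_pushforward//;
  exact: measurable_funTS.
Qed.

End density.

Section uniqueness.
Context {R : realType} {dS : measure_display} {S : measurableType dS}.
Variable mu : {finite_measure set S -> \bar R}.
Local Open Scope ereal_scope.

(** The test set is {g < 0}: there the integral of [g] is both nonpositive and nonnegative, so [g]
    would vanish almost everywhere on it. *)
Lemma ae_ge0_of_integral (g : S -> \bar R) : measurable_fun setT g ->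
  (forall b, measurable b -> 0 <= \int[mu]_(y in b) g y) ->
  {ae mu, forall y, 0 <= g y}.
Proof.
move=> mg g0; pose N := [set y | g y < 0].
have mN : measurable N.
  by rewrite -[X in measurable X]setTI; exact: emeasurable_fun_infty_o.
have mNg : measurable_fun N g by exact: measurable_funTS.
have : \int[mu]_(y in N) `|g y| = 0.
  apply/eqP; rewrite eq_le integral_ge0// andbT.
  under eq_integral => y /[!inE] yN do rewrite lte0_abs//.
  rewrite -oppe_ge0 -integral_ge0N => [|y /= yN]; last by rewrite oppe_ge0 ltW.
  by under eq_integral do rewrite oppeK; exact: g0.
move=> /(ae_eq_integral_abs mu mN mNg); apply: filterS => y /= gy.
by rewrite leNgt; apply/negP => gy0; move: (gy0); rewrite gy// ltxx.
Qed.

(** Neither function is assumed integrable. They are compared where one of them lies in [0, n],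
    hence is integrable because [mu] is finite, and n runs over the naturals; what remains is the
    set where both are [+oo]. *)
Lemma ae_eq_of_integral (g h : S -> \bar R) :
  measurable_fun setT g -> measurable_fun setT h ->
  (forall b, measurable b -> 0 <= \int[mu]_(y in b) g y) ->
  (forall b, measurable b -> \int[mu]_(y in b) g y = \int[mu]_(y in b) h y) ->
  {ae mu, forall y, g y = h y}.
Proof.
move=> mg mh g0 gh.
have bounded_case (f k : S -> \bar R) n : measurable_fun setT f ->
    measurable_fun setT k ->
    (forall b, measurable b -> \int[mu]_(y in b) f y = \int[mu]_(y in b) k y) ->
    {ae mu, forall y, 0 <= f y <= n%:R%:E -> f y = k y}.
  move=> mf mk fk; pose D := [set y | 0 <= f y] `&` [set y | f y <= n%:R%:E].
  have mD : measurable D.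
    apply: measurableI; rewrite -[X in measurable X]setTI.
      exact: emeasurable_fun_c_infty.
    exact: emeasurable_fun_infty_c.
  have intf : mu.-integrable D f.
    apply: (@le_integrable _ _ _ _ _ mD _ (cst n%:R%:E)).
    - exact: measurable_funTS.
    - by move=> y [/= f0 fn]; rewrite gee0_abs// (le_trans fn)// lee_abs.
    - exact: finite_measure_integrable_cst.
  have := integral_ae_eq mD intf (measurable_funTS mk) (fun b _ mb => fk b mb).
  by apply: filterS => y /= Dy /andP[f0 fn]; exact: Dy.
have h0 b (mb : measurable b) : 0 <= \int[mu]_(y in b) h y by rewrite -gh// g0.
have gh_ge0 : {ae mu, forall y, 0 <= g y /\ 0 <= h y}.
  by move: (ae_ge0_of_integral g mg g0) (ae_ge0_of_integral h mh h0);
    apply: filterS2.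
have Hg := ae_foralln (fun n => bounded_case g h n mg mh gh).
have Hh := ae_foralln (fun n => bounded_case h g n mh mg (fun b mb => esym (gh
  b mb))).
move: Hh Hg gh_ge0; apply: filterS3 => y /= hg gh' [gy hy].
have fin_bound (x : \bar R) : 0 <= x -> x < +oo -> exists n, 0 <= x <= n%:R%:E.
  move=> x0 xoo; exists (Num.truncn (fine x)).+1; rewrite x0/=.
  by rewrite -(fineK (x := x)) ?ge0_fin_numE// lee_fin ltW// truncnS_gt.
have := leey (g y); rewrite le_eqVlt => /predU1P[gyoo|gyoo].
  have := leey (h y); rewrite le_eqVlt => /predU1P[hyoo|hyoo].
    by rewrite gyoo hyoo.
  by have [n /hg] := fin_bound _ hy hyoo.
by have [n /gh'] := fin_bound _ gy gyoo.
Qed.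

End uniqueness.

(** * Setwise convergence of laws *)

Section setwise_convergence.
Context {R : realType} {dT dS : measure_display}.
Context {T : measurableType dT} {S : measurableType dS}.
Variable P : probability T R.
Local Open Scope ereal_scope.
Variables (Yn : nat -> T -> S) (Y : T -> S).
Hypotheses (mYn : forall n, measurable_fun setT (Yn n)) (mY : measurable_fun
  setT Y).

Import HBNNSimple.

(** Setwise convergence passes to simple functions at once. A simple h below [psi] gives E(h(Y); D)
    = lim E(h(Yn); D) <= l, and h increases to [psi]. *)
Lemma setwise_fatou (D : set T) (psi : S -> \bar R) (l : \bar R) :
  measurable D -> measurable_fun setT psi -> (forall y, 0 <= psi y) ->
  (forall b, measurable b -> P (D `&` Yn n @^-1` b) @[n --> \oo] -->
    P (D `&` Y @^-1` b)) ->
  \int[P]_(x in D) psi (Yn n x) @[n --> \oo] --> l ->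
  \int[P]_(x in D) psi (Y x) <= l.
Proof.
move=> mD mpsi psi0 PYn Il.
have mpre (Z : T -> S) b : measurable_fun setT Z -> measurable b ->
  measurable (Z @^-1` b).
  by move=> mZ mb; rewrite -[X in measurable X]setTI; apply: mZ.
have := @cvg_integral_comp_approx _ _ _ _ _ P D (cst 1) Y psi mpsi mD
  (measurable_cst _) (fun=> lee01) mY psi0.
under [X in _ --> X]eq_integral do rewrite mule1.
move=> cvgk; rewrite -(cvg_lim (@ereal_hausdorff R) cvgk).
apply: lime_le; first by apply/cvg_ex; eexists; exact: cvgk.
apply: nearW => k; set h := nnsfun_approx measurableT mpsi k.
rewrite -(cvg_lim (@ereal_hausdorff R) Il).
have : \int[P]_(x in D) ((h (Yn n x))%:E * cst 1 x) @[n --> \oo] -->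
       \int[P]_(x in D) ((h (Y x))%:E * cst 1 x).
  rewrite integral_comp_nnsfun// fsbig_finite//=.
  under eq_fun do rewrite integral_comp_nnsfun// fsbig_finite//=.
  apply: cvg_nnesum => r _.
    apply: nearW => n; have [r0|r0] := leP 0%R r.
      by rewrite mule_ge0 ?integral_ge0// lee_fin.
    by rewrite (preimage_nnfun0 h r0) preimage_set0 setI0 integral_set0 mule0.
  apply: cvgeZl => //.
  have intE (Z : T -> S) : measurable_fun setT Z ->
      \int[P]_(x in D `&` Z @^-1` (h @^-1` [set r])) cst 1 x =
      P (D `&` Z @^-1` (h @^-1` [set r])).
    move=> mZ; rewrite integral_cst ?mul1e//.
    by apply: measurableI => //; exact: mpre.
  rewrite intE//; under eq_fun do rewrite intE//.
  exact: PYn.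
move=> hY; rewrite -(cvg_lim (@ereal_hausdorff R) hY).
apply: lee_lim.
- by apply/cvg_ex; eexists; exact: hY.
- by apply/cvg_ex; eexists; exact: Il.
apply: nearW => n; apply: ge0_le_integral => //.
- by move=> x _; rewrite mule1 lee_fin.
- apply: emeasurable_funM => //; apply/measurable_EFinP/measurable_funTS.
  exact: measurableT_comp.
- by apply/measurable_funTS; exact: measurableT_comp.
- move=> x _; rewrite mule1 /h nnsfun_approxE.
  by apply: le_approx => //.
Qed.

End setwise_convergence.

Section setwise_convergence_of_laws.
Context {R : realType} {dT : measure_display} {T : measurableType dT}.
Variable P : probability T R.
Context {E : ptopologicalType}.
Variables (Yn : nat -> T -> borel E) (Y : T -> borel E).
Hypotheses (mYn : forall n, measurable_fun setT (Yn n)) (mY : measurable_fun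
  setT Y).
Hypothesis Yn_Y : forall w, (Yn n w : E) @[n --> \oo] --> (Y w : E).
Hypothesis cvg_law : forall C, measurable C ->
  P (Yn n @^-1` C) @[n --> \oo] --> P (Y @^-1` C).

Let pr A := fine (P A).

Let prE A : measurable A -> P A = (pr A)%:E.
Proof. by move=> mA; rewrite fineK// fin_num_measure. Qed.

Let pr_ge0 A : 0 <= pr A. Proof. exact: fine_ge0. Qed.

Let pr_le A B : measurable A -> measurable B -> A `<=` B -> pr A <= pr B.
Proof.
by move=> mA mB AB; rewrite -lee_fin -!prE//; apply: le_measure; rewrite ?inE.
Qed.

Let prU A B : measurable A -> measurable B -> pr (A `|` B) <= pr A + pr B.
Proof.
by move=> mA mB; rewrite -lee_fin EFinD -!prE//;
  [exact: measureU2|exact: measurableU].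
Qed.

Let prDI A B : measurable A -> measurable B -> pr A =
  pr (A `\` B) + pr (A `&` B).
Proof.
move=> mA mB; apply: EFin_inj; rewrite EFinD -!prE//; first exact: measureDI.
- exact: measurableI.
- exact: measurableD.
Qed.

Let pr_cvg0 (F : nat -> set T) : (forall n, measurable (F n)) ->
  nonincreasing_seq F -> \bigcap_n F n = set0 -> pr (F n) @[n --> \oo] -->
    (0 : R).
Proof.
move=> mF niF F0; rewrite (_ : 0 = fine (P (\bigcap_n F n)));
  last by rewrite F0 measure0.
apply: fine_cvg; rewrite fineK ?fin_num_measure//;
  last exact: bigcapT_measurable.
apply: nonincreasing_cvg_mu => //; last exact: bigcapT_measurable.
by rewrite (le_lt_trans (probability_le1 P (mF 0%N)))// ltry.
Qed.

Let mpre (Z : T -> borel E) C : measurable_fun setT Z -> measurable C ->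
  measurable (Z @^-1` C).
Proof. by move=> mZ mC; rewrite -[X in measurable X]setTI; apply: mZ. Qed.

Let miss n C := Y @^-1` C `\` Yn n @^-1` C.

Let mmiss n C : measurable C -> measurable (miss n C).
Proof. by move=> mC; apply: measurableD; exact: mpre. Qed.

(* The good sets form a sigma-algebra: open sets are good because Yn -> Y
   pointwise, and closure under complement is where the convergence of the laws
   is used. *)
Let good (C : set (borel E)) := measurable C /\ (pr (miss n C) @[n -->
  \oo] --> (0 : R)).

Let good_open (C : set (borel E)) : @open E C -> good C.
Proof.
move=> oC; have mC : measurable C by exact: sub_sigma_algebra.
(* [B n] is the event of a miss at some index at least [n]. It decreases to the empty set, since a
   sequence with limit in an open set is eventually in that set. *)
split=> //; pose B n := \bigcup_(m in [set m | (n <= m)%N]) miss m C.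
have mB n : measurable (B n) by apply: bigcup_measurable => m _; exact: mmiss.
have B0 : pr (B n) @[n --> \oo] --> (0 : R).
  apply: pr_cvg0 => //.
  - move=> m n mn; apply/subsetPset => w [k /= nk wk]; exists k => //=.
    exact: leq_trans nk.
  - rewrite -subset0 => w Bw.
    have [m0 _ [Ym0 _]] := Bw 0%N I.
    have [N _ YN] := Yn_Y w C (open_nbhs_nbhs (conj oC Ym0)).
    by have [m /= Nm [_]] := Bw N I; apply; exact: YN.
apply: (squeeze_cvgr _ (cvg_cst 0) B0); apply: nearW => n.
rewrite pr_ge0 pr_le//; first exact: mmiss.
by move=> w wn; exists n => //=.
Qed.

Let goodC (C : set (borel E)) : good C -> good (~` C).
Proof.
move=> [mC C0]; split; first exact: measurableC.
(* The events Yn in C and Y in C share their intersection, so the two one-sided mismatches differ by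
   the difference of the laws. *)
have eqC n : pr (miss n (~` C)) =
  pr (Yn n @^-1` C) - pr (Y @^-1` C) + pr (miss n C).
  rewrite (prDI (Yn n @^-1` C) (Y @^-1` C)); [|exact: mpre..].
  rewrite [pr (Y @^-1` C)](prDI _ (Yn n @^-1` C)); [|exact: mpre..].
  rewrite -/(miss n C) (setIC (Y @^-1` C)).
  rewrite (_ : miss n (~` C) = Yn n @^-1` C `\` Y @^-1` C).
    by rewrite opprD addrACA subrr addr0 subrK.
  apply/seteqP; split => w /=; rewrite /miss/=.
    by move=> [nY /contrapT].
  by move=> [? ?]; split => //; apply.
under eq_fun do rewrite eqC.
rewrite (_ : 0 = pr (Y @^-1` C) - pr (Y @^-1` C) + 0);
  last by rewrite subrr addr0.
apply: cvgD => //; apply: cvgB; last exact: cvg_cst.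
apply: fine_cvg; rewrite -prE; last exact: mpre.
exact: cvg_law.
Qed.

Let goodU (C D : set (borel E)) : good C -> good D -> good (C `|` D).
Proof.
move=> [mC C0] [mD D0]; split; first exact: measurableU.
have CD0 : pr (miss n C) + pr (miss n D) @[n --> \oo] --> (0 : R).
  by rewrite -[0]addr0; exact: cvgD.
apply: (squeeze_cvgr _ (cvg_cst 0) CD0); apply: nearW => n.
rewrite pr_ge0/= (le_trans _ (prU _ _ _ _))//; [|exact: mmiss..].
apply: pr_le.
- by apply: mmiss; exact: measurableU.
- by apply: measurableU; exact: mmiss.
- move=> w [[Cw|Dw]] /not_orP[nC nD]; by [left|right].
Qed.

(** Finite unions are good, and the part of the union beyond [D N] is controlled by the law of [Y]
    alone, hence uniformly in [n]. *)
Let good_bigcup (C : nat -> set (borel E)) :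
  (forall k, good (C k)) -> good (\bigcup_k C k).
Proof.
move=> gC; have mC k : measurable (C k) by have [] := gC k.
have mU : measurable (\bigcup_k C k) by exact: bigcup_measurable.
split => //; pose D N := \big[setU/set0]_(k < N) C k.
have gD N : good (D N).
  rewrite /D; elim: N => [|N IH]; last by rewrite big_ord_recr; exact: goodU.
  by rewrite big_ord0; apply: good_open; exact: open0.
have mD N : measurable (D N) by have [] := gD N.
pose V N := Y @^-1` (\bigcup_k C k) `\` Y @^-1` D N.
have mV N : measurable (V N) by apply: measurableD; exact: mpre.
have V0 : pr (V N) @[N --> \oo] --> (0 : R).
  apply: pr_cvg0 => //.
  - move=> m n mn; apply/subsetPset => w [Cw nD]; split => // Dm; apply: nD.
    by move: Dm; apply: subset_bigsetU.
  - rewrite -subset0 => w Vw; have [[k _ Ck] _] := Vw 0%N I.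
    have [_] := Vw k.+1 I; apply; rewrite /D /= big_ord_recr/=; by right.
apply/cvgr0Pnorm_lt => e e0; near \oo => N.
have VN : pr (V N) < e / 2.
  rewrite -[ltLHS]ger0_norm//; near: N.
  by move/cvgr0Pnorm_lt : V0; apply; rewrite divr_gt0.
have [_ /cvgr0Pnorm_lt /(_ (e / 2))] := gD N; rewrite divr_gt0// => /(_ isT).
apply: filterS => n; rewrite !ger0_norm// => DNn.
rewrite (splitr e) (le_lt_trans _ (ltrD VN DNn))//.
apply: (le_trans _ (prU _ _ _ _)) => //; last exact: mmiss.
apply: pr_le.
- exact: mmiss.
- by apply: measurableU => //; exact: mmiss.
- move=> w [Cw nC]; have [DNw|DNw] := pselect ((Y @^-1` D N) w); last by left.
  right; split=> // Dn; apply: nC; move: Dn.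
  by rewrite /preimage/= /D -bigcup_mkord => -[k _ Ck]; exists k.
Unshelve. all: by end_near. Qed.

Let good_measurable (C : set (borel E)) : measurable C -> good C.
Proof.
move: C; apply: smallest_sub; last exact: good_open.
split => [|A gA|A gA].
- by apply: good_open; exact: open0.
- by rewrite setTD; exact: goodC.
- exact: good_bigcup.
Qed.

(** The two events differ only where exactly one of [Y] and [Yn n] is in [C], that is on a miss of
    [C] or of its complement; this bound does not involve [A]. *)
Lemma cvg_setwise A C : measurable A -> measurable C ->
  (P (A `&` Yn n @^-1` C) @[n --> \oo] --> P (A `&` Y @^-1` C))%E.
Proof.
move=> mA mC; have [_ C0] := good_measurable C mC.
have [_ C0'] := good_measurable _ (measurableC mC).
have mAZ Z : measurable_fun setT Z -> measurable (A `&` Z @^-1` C).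
  by move=> mZ; apply: measurableI => //; exact: mpre.
rewrite prE; last exact: mAZ.
under eq_fun do (rewrite prE; last exact: mAZ).
apply: cvg_EFin; first exact: nearW.
have s0 : pr (miss n C) + pr (miss n (~` C)) @[n --> \oo] --> (0 : R).
  by rewrite -[0]addr0; exact: cvgD.
apply/subr_cvg0/norm_cvg0P; apply: (squeeze_cvgr _ (cvg_cst 0) s0).
apply: nearW => n /=; rewrite normr_ge0/=.
have le1 : pr (A `&` Y @^-1` C) <= pr (A `&` Yn n @^-1` C) + pr (miss n C).
  apply: (le_trans _ (prU _ _ _ _)); [|exact: mAZ|exact: mmiss].
  apply: pr_le; [exact: mAZ|by apply: measurableU; [exact: mAZ|exact: mmiss]|].
  by move=> w [Aw Cw]; have [Cn|nCn] := pselect (C (Yn n w)); [left|right].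
have le2 : pr (A `&` Yn n @^-1` C) <= pr (A `&` Y @^-1` C) + pr (miss n (~` C)).
  have mCC := mmiss n _ (measurableC mC).
  apply: (le_trans _ (prU _ _ _ _)); [|exact: mAZ|by []].
  apply: pr_le; [exact: mAZ|by apply: measurableU; [exact: mAZ|]|].
  move=> w [Aw Cn]; have [Cw|nCw] := pselect (C (Y w)); [by left|right].
  by split => //=; apply.
have := pr_ge0 (miss n C); have := pr_ge0 (miss n (~` C)).
by move: le1 le2; rewrite ler_norml; lra.
Qed.

End setwise_convergence_of_laws.
Lemma cvg_minr {R : realType} (a : nat -> R) (c : R) :
  a n @[n --> \oo] --> c -> Num.min (a n) c @[n --> \oo] --> c.
Proof.
move=> ac; have norm0 : `|a n - c| @[n --> \oo] --> (0 : R).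
  by apply/norm_cvg0P/subr_cvg0.
have low : c - `|a n - c| @[n --> \oo] --> c.
  by rewrite -[X in _ --> X]subr0; apply: cvgB => //; exact: cvg_cst.
apply: (squeeze_cvgr _ low (cvg_cst c)); apply: nearW => n.
rewrite ge_min lexx orbT andbT le_min gerBl normr_ge0 andbT.
by rewrite lerBlDl -lerBlDr distrC ler_norm.
Qed.
(** * Shifts, evolution and conditional laws *)

Lemma expectationE {d} {T : measurableType d} {R : realType}
  (P : probability T R) (f : T -> R) : ('E_P[f] = \int[P]_w (f w)%:E)%E.
Proof. by rewrite expectation.unlock. Qed.

Section process_facts.
Context {R : realType} {dO : measure_display} {Omega : measurableType dO}.
Variable P : probability Omega R.
Context {E : ptopologicalType}.
Variable X : R -> Omega -> E.
Hypothesis mX : forall t, 0 <= t -> measurable_fun setT (X t : Omega ->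
  borel E).

Local Notation G := (sigma_gen X `[0, +oo[).
Local Notation past t := (sigma_gen X `[0, t]).
Local Notation GOmega := (g_sigma_algebraType G).
Local Notation evt t b := ((X t : Omega -> borel E) @^-1` b).

Lemma measurable_evt t (b : set (borel E)) : 0 <= t -> measurable b ->
  measurable (evt t b).
Proof. by move=> t0 mb; rewrite -[X in measurable X]setTI; exact: mX. Qed.

Lemma sigma_gen_evt (I : set R) t (b : set (borel E)) :
  I t -> measurable b -> sigma_gen X I (evt t b).
Proof.
move=> It mb; apply: sub_gen_smallest; exists t => //.
by exists b => //; rewrite setTI.
Qed.

Lemma G_evt t (b : set (borel E)) : 0 <= t -> measurable b -> G (evt t b).
Proof. by move=> t0 mb; apply: sigma_gen_evt => //; rewrite /= in_itv/= t0. Qed.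

Lemma sub_sigma_gen (I J : set R) : I `<=` J ->
  sigma_gen X I `<=` sigma_gen X J.
Proof. by move=> IJ; apply: sub_sigma_algebra2; exact: bigcup_subset. Qed.

Lemma sigma_gen_measurable (I : set R) : (forall t, I t -> 0 <= t) ->
  sigma_gen X I `<=` measurable.
Proof.
move=> I0; apply: smallest_sub; first exact: sigma_algebra_measurable.
move=> _ [t It [b mb <-]]; rewrite setTI; apply: measurable_evt => //;
  exact: I0.
Qed.

Lemma G_measurable : G `<=` measurable.
Proof. by apply: sigma_gen_measurable => t /=; rewrite in_itv/= andbT. Qed.

Lemma sigma_gen_preimage (I J : set R) (f : Omega -> Omega) (c : R) :
  (forall t w, I t -> X t (f w) = X (c + t) w) -> (forall t, I t ->
    J (c + t)) ->
  forall B, sigma_gen X I B -> sigma_gen X J (f @^-1` B).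
Proof.
move=> fX IJ; apply: smallest_sub.
  split=> [|A GA|A GA].
  - rewrite /= preimage_set0; exact: sigma_algebra0.
  - by rewrite setTD/= preimage_setC; exact: sigma_algebraC.
  - by rewrite /= preimage_bigcup; exact: sigma_algebra_bigcup.
move=> _ [t It [b mb <-]]; rewrite /= setTI.
rewrite (_ : _ @^-1` _ = evt (c + t) b); last first.
  by apply/funext => w /=; rewrite fX.
exact: sigma_gen_evt (IJ _ It) mb.
Qed.

(** [theta] is known only through its effect on the paths of [X], so it need not be a semigroup on
    [Omega]. Events generated by [X] see only the path, hence the semigroup identities hold for
    their preimages. *)
Lemma sigma_gen_preimage_eq (I : set R) (f g : Omega -> Omega) :
  (forall t w, I t -> X t (f w) = X t (g w)) ->
  forall B, sigma_gen X I B -> f @^-1` B = g @^-1` B.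
Proof.
move=> fg B GB; apply/funext => w; move: B GB.
apply: smallest_sub.
  split=> [//|A /= fgA|A /= fgA].
    by congr (_ /\ ~ _).
  by apply/propext; split => -[k _ Ak]; exists k => //;
    [rewrite -fgA|rewrite fgA].
by move=> _ [t It [b mb <-]]; rewrite setTI /= fg.
Qed.

Variable theta : R -> Omega -> Omega.
Hypothesis theta_X : shift_operators X theta.

Lemma G_shift t B : 0 <= t -> G B -> G (theta t @^-1` B).
Proof.
move=> t0; apply: (sigma_gen_preimage _ _ _ t) => s; rewrite /= in_itv/= andbT.
  by move=> w s0; rewrite theta_X.
by move=> s0; rewrite in_itv/= andbT addr_ge0.
Qed.

Lemma shift_shift s t B : 0 <= s -> 0 <= t -> G B ->
  theta s @^-1` (theta t @^-1` B) = theta (s + t) @^-1` B.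
Proof.
move=> s0 t0 GB; apply: (@sigma_gen_preimage_eq _ (theta t \o theta s) _ _ _
  GB).
move=> r w; rewrite /= in_itv/= andbT => r0.
by rewrite !theta_X ?addr_ge0// addrA.
Qed.

Lemma shift0 B : G B -> theta 0 @^-1` B = B.
Proof.
move=> GB; rewrite -[RHS]preimage_id;
  apply: (@sigma_gen_preimage_eq _ _ _ _ _ GB).
by move=> r w; rewrite /= in_itv/= andbT => r0; rewrite theta_X ?add0r.
Qed.

Lemma shift_evt s t (b : set (borel E)) : 0 <= s -> 0 <= t ->
  theta s @^-1` (evt t b) = evt (s + t) b.
Proof. by move=> s0 t0; apply/funext => w /=; rewrite theta_X. Qed.

Lemma measurable_GE (B : set GOmega) : measurable B = G B.
Proof.
rewrite /measurable/= sigma_algebra_id//; exact: smallest_sigma_algebra.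
Qed.

Lemma measurable_shift t : 0 <= t ->
  measurable_fun setT (theta t : Omega -> GOmega).
Proof.
move=> t0 _ B; rewrite measurable_GE setTI => GB.
by apply: G_measurable; exact: G_shift.
Qed.

Lemma measurable_idG : measurable_fun setT (id : Omega -> GOmega).
Proof.
by move=> _ B; rewrite measurable_GE setTI preimage_id; exact: G_measurable.
Qed.

Section transport.
Local Open Scope ereal_scope.

(** The case of [eq_integral_comp] with weight 1 on the left: an identity of measures with density
    [V] becomes an identity for all nonnegative test functions. Most changes of measure below are
    instances. *)
Lemma eq_measure_integral_comp {d dS} {T : measurableType d} {S :
  measurableType dS}
    (Q : probability T R) (D : set Omega) (D' : set T) (V : T -> \bar R)
    (Y : Omega -> S) (Y' : T -> S) (psi : S -> \bar R) :
  measurable D -> measurable D' ->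
  measurable_fun setT V -> (forall x, 0 <= V x) ->
  measurable_fun setT Y -> measurable_fun setT Y' ->
  measurable_fun setT psi -> (forall y, 0 <= psi y) ->
  (forall b, measurable b -> P (D `&` Y @^-1` b) =
    \int[Q]_(x in D' `&` Y' @^-1` b) V x) ->
  \int[P]_(x in D) psi (Y x) = \int[Q]_(x in D') (psi (Y' x) * V x).
Proof.
move=> mD mD' mV V0 mY mY' mpsi psi0 PV.
rewrite -(@eq_integral_comp _ _ _ _ _ _ _ P Q D D' mD mD' (cst 1) V _ mV _ V0
  Y)//.
  by under [RHS]eq_integral do rewrite mule1.
move=> b mb; rewrite -PV// integral_cst ?mul1e//.
by apply: measurableI => //; rewrite -[X in measurable X]setTI; exact: mY.
Qed.

End transport.

Variable F : R -> E -> R.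
Hypothesis foed_X : FOED P X F.
Local Open Scope ereal_scope.

Local Notation e t x := (exp_evolution F t x)%:E.

Lemma exp_evolution_ge0 t x : 0 <= e t x.
Proof. by rewrite lee_fin expR_ge0. Qed.

Lemma measurable_exp_evolution t :
  measurable_fun setT (fun x : borel E => e t x).
Proof.
case: foed_X => mF _ _.
apply/measurable_EFinP; apply: measurableT_comp => //.
(* [F] is known to be measurable only at nonnegative times, so it is cut off to the strip [0, t]
   before Tonelli is applied to its positive and negative parts. *)
pose D : set (R * borel E) := `[0%R, t]%classic `*` setT.
have mD : measurable D by apply: measurableX.
pose f := (fun uy : R * borel E => (F uy.1 uy.2)%:E) \_ D.
have mf : measurable_fun setT f.
  apply/(measurable_restrictT _ mD)/measurable_EFinP; apply: measurable_funS mF.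
    rewrite [X in measurable X](_ : _ = `[0%R, +oo[%classic `*` setT).
      exact: measurableX.
    by apply/seteqP; split => [[u y] /= u0|[u y] [/= + _]];
      rewrite ?in_itv/= ?andbT.
  by move=> [u y] [/= + _]; rewrite in_itv/= => /andP[].
rewrite (_ : (fun x : borel E => _) =
    fun x => fine (\int[lebesgue_measure]_u f^\+ (u, x) -
                   \int[lebesgue_measure]_u f^\- (u, x))); last first.
  apply/funext => x; rewrite /Rintegral integral_mkcond integralE.
  have fE u : ((fun u => (F u x)%:E) \_ `[0%R, t]) u = f (u, x).
    rewrite /f /D !patchE; congr (if _ then _ else _).
    by apply/idP/idP; rewrite !inE/= => -[].
  congr (fine (_ - _)); apply: eq_integral => u _.
    by rewrite !funeposE fE.
  by rewrite !funenegE fE.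
apply: measurableT_comp => //; apply: emeasurable_funB.
- apply: (@measurable_fun_fubini_tonelli_G _ _ _ _ _ (@lebesgue_measure R)
  (f^\+)) => //.
  exact: measurable_funepos.
- apply: (@measurable_fun_fubini_tonelli_G _ _ _ _ _ (@lebesgue_measure R)
  (f^\-)) => //.
  exact: measurable_funeneg.
Qed.

Lemma foed_measure t (b : set (borel E)) : (0 <= t)%R -> measurable b ->
  P (evt t b) = \int[P]_(w in evt 0 b) e t (X 0 w).
Proof.
move=> t0 mb; case: foed_X => _ _ foed.
have mb1 : measurable_fun setT (\1_b : borel E -> R) by [].
have b1 : exists M, forall x : borel E, (`|\1_b x : R| <= M)%R.
  by exists 1%R => x; rewrite indicE; case: (x \in b); rewrite ?normr1 ?normr0.
have := foed _ mb1 b1 t t0; rewrite !expectationE.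
rewrite (_ : (\int[P]_w (\1_b (X t w))%:E) = P (evt t b)); last first.
  transitivity (\int[P]_w (\1_(evt t b) w)%:E) => //.
  by rewrite integral_indic ?setIT//; exact: measurable_evt.
move=> ->; rewrite [RHS]integral_mkcond; apply: eq_integral => w _.
rewrite patchE indicE (_ : (X 0 w \in b) = (w \in evt 0 b)); last first.
  by apply/idP/idP; rewrite !inE.
by case: ifPn => _; rewrite ?mul1r// mul0r.
Qed.

Lemma foed_integral t (b : set (borel E)) (psi : borel E -> \bar R) : (0 <=
  t)%R ->
  measurable b -> measurable_fun setT psi -> (forall x, 0 <= psi x) ->
  \int[P]_(w in evt t b) psi (X t w) =
  \int[P]_(w in evt 0 b) (psi (X 0 w) * e t (X 0 w)).
Proof.
move=> t0 mb mpsi psi0.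
apply: (@eq_measure_integral_comp _ _ _ (borel E) P (evt t b) (evt 0 b)
  (fun w => e t (X 0 w)) (X t) (X 0) psi) => //; try exact: measurable_evt;
    try exact: mX.
- by apply: measurableT_comp (measurable_exp_evolution t) _; exact: mX.
- by move=> w; exact: exp_evolution_ge0.
- by move=> b' mb'; apply: (foed_measure t (b `&` b')) => //;
  exact: measurableI.
Qed.

Variable Px : R.-pker (borel E) ~> GOmega.
Hypothesis Px_X : regular_cond_prob P X Px.

Lemma measurable_Px B : G B -> measurable_fun setT (fun x : borel E => Px x B).
Proof. by move=> GB; apply: measurable_kernel; rewrite measurable_GE. Qed.

Lemma measurable_Px_X t B : (0 <= t)%R -> G B ->
  measurable_fun setT (fun w => Px (X t w) B).
Proof.
by move=> t0 GB; apply: measurableT_comp (measurable_Px _ GB) _; exact: mX.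
Qed.

Lemma regular_measure B (b : set (borel E)) : G B -> measurable b ->
  P (B `&` evt 0 b) = \int[P]_(w in evt 0 b) Px (X 0 w) B.
Proof.
move=> GB mb; have [_ [_ /(_ (evt 0 b))]] := Px_X B GB.
move=> ->; last by exists b => //; rewrite setTI.
by rewrite integral_indic//; [exact: measurable_evt|exact: G_measurable].
Qed.

Lemma regular_integral B (psi : borel E -> \bar R) : G B ->
  measurable_fun setT psi -> (forall x, 0 <= psi x) ->
  \int[P]_(w in B) psi (X 0 w) = \int[P]_w (psi (X 0 w) * Px (X 0 w) B).
Proof.
move=> GB mpsi psi0.
apply: (@eq_measure_integral_comp _ _ _ (borel E) P B setT
  (fun w => Px (X 0 w) B) (X 0) (X 0) psi) => //.
- exact: G_measurable.
- exact: measurable_Px_X.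
- exact: mX.
- exact: mX.
- by move=> b mb; rewrite setTI; exact: regular_measure.
Qed.

(* The simple Markov property at time t, tested on an event A of the past and on
   the event theta_t^-1(B) of the future. *)
Definition markov_at (A : set Omega) t (B : set Omega) :=
  P (A `&` theta t @^-1` B) = \int[P]_(w in A) Px (X t w) B.

(** Once X_t on [A] has density [rho] against the initial law, both sides equal E(rho(X_0)
    P_{X_0}(B)). The Markov property for [A] thus becomes P(A, theta_t^-1 B) = E(rho(X_0); B), free
    of [Px]. *)
Lemma past_integral A t (rho : borel E -> \bar R) :
  measurable A -> (0 <= t)%R ->
  measurable_fun setT rho -> (forall x, 0 <= rho x) ->
  (forall b : set (borel E), measurable b ->
    P (A `&` evt t b) = \int[P]_(w in evt 0 b) rho (X 0 w)) ->
  forall B, G B -> \int[P]_(w in A) Px (X t w) B = \int[P]_(w in B) rho (X 0 w).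
Proof.
move=> mA t0 mrho rho0 Arho B GB; rewrite regular_integral//.
under [RHS]eq_integral do rewrite muleC.
apply: (@eq_measure_integral_comp _ _ _ (borel E) P A setT
  (fun w => rho (X 0 w)) (X t) (X 0) (fun x => Px x B)) => //.
- by apply: measurableT_comp mrho _; exact: mX.
- exact: mX.
- exact: mX.
- exact: measurable_Px.
- by move=> b mb; rewrite setTI Arho.
Qed.

(* By FOED the law of X_t is absolutely continuous with respect to that of X_0,
   so conditioning on A acts on the future like a density on the initial law. *)
Lemma past_density A t : measurable A -> (0 <= t)%R ->
  exists rho : borel E -> \bar R,
    [/\ measurable_fun setT rho, forall x, 0 <= rho x &
        forall b : set (borel E), measurable b ->
          P (A `&` evt t b) = \int[P]_(w in evt 0 b) rho (X 0 w)].
Proof.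
move=> mA t0; have [psi [mpsi psi0 psiE]] := density_along P _ _ (mX t t0) mA.
exists (fun x => psi x * e t x); split.
- exact: emeasurable_funM mpsi (measurable_exp_evolution t).
- by move=> x; rewrite mule_ge0// exp_evolution_ge0.
- by move=> b mb; rewrite psiE//; exact: foed_integral.
Qed.

(** * Cylinders and the simple Markov property *)

Definition cylinder (l : seq (R * set (borel E))) : set Omega :=
  [set w | all (fun p => (X p.1 w : borel E) \in p.2) l].

Definition cylinder_in (I : set R) (l : seq (R * set (borel E))) :=
  all (fun p => `[< I p.1 /\ measurable p.2 >]) l.

Lemma cylinder_cons p l : cylinder (p :: l) = evt p.1 p.2 `&` cylinder l.
Proof.
apply/seteqP; split => w /=; first by move=> /andP[]; rewrite inE.
by move=> [? ?]; apply/andP; split => //; rewrite inE.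
Qed.

Lemma cylinder_nil : cylinder [::] = setT.
Proof. by apply/seteqP; split. Qed.

Lemma cylinder_cat l1 l2 :
  cylinder (l1 ++ l2) = cylinder l1 `&` cylinder l2.
Proof.
by apply/seteqP; split => w; rewrite /cylinder/= all_cat;
  [move=> /andP[]|move=> [-> ->]].
Qed.

Lemma cylinder_sigma_gen I l : cylinder_in I l -> sigma_gen X I (cylinder l).
Proof.
elim: l => [_|p l IH].
  by rewrite cylinder_nil -setC0; apply: sigma_algebraC; exact: sigma_algebra0.
move=> /= /andP[/asboolP[Ip mp] /IH gl]; rewrite cylinder_cons.
have mI : setI_closed (@measurable _ (g_sigma_algebraType (sigma_gen X I))).
  exact: measurableI.
have gE : (@measurable _ (g_sigma_algebraType (sigma_gen X I))) = sigma_gen X I.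
  by rewrite /measurable/= sigma_algebra_id//; exact: smallest_sigma_algebra.
by rewrite -gE; apply: mI; rewrite gE//; exact: sigma_gen_evt.
Qed.

Lemma sigma_genE I : sigma_gen X I = <<s cylinder @` cylinder_in I >>.
Proof.
apply/seteqP; split; apply: smallest_sub; try exact: smallest_sigma_algebra.
- move=> _ [t It [b mb <-]]; rewrite setTI; apply: sub_gen_smallest.
  exists [:: (t, b)]; first by rewrite /cylinder_in/= andbT; apply/asboolP.
  by rewrite cylinder_cons cylinder_nil setIT.
- by move=> _ [l lI <-]; exact: cylinder_sigma_gen.
Qed.

Lemma cylinder_setI I : setI_closed (cylinder @` cylinder_in I).
Proof.
move=> _ _ [l1 ? <-] [l2 ? <-]; exists (l1 ++ l2); last exact: cylinder_cat.
by rewrite /cylinder_in/= all_cat; apply/andP.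
Qed.

Lemma cylinder_setT I : (cylinder @` cylinder_in I) setT.
Proof. by exists [::] => //; exact: cylinder_nil. Qed.

Let time_le (p q : R * set (borel E)) := (p.1 <= q.1)%R.

(** The event does not depend on the order of its constraints, so the head of the list may be taken
    as the earliest time. *)
Lemma cylinder_sorted_ind I (Q : set Omega -> Prop) :
  (forall l, sorted time_le l -> cylinder_in I l -> Q (cylinder l)) ->
  forall l, cylinder_in I l -> Q (cylinder l).
Proof.
move=> QI l lI.
have -> : cylinder l = cylinder (sort time_le l).
  by apply/seteqP; split => w; rewrite /cylinder/= all_sort.
apply: QI; last by rewrite /cylinder_in all_sort.
by apply: sort_sorted => p q; exact: le_total.
Qed.

(** Sortedness makes every later time at least [r], so the differences are nonnegative and [theta_X]
    applies to them. *)
Lemma cylinder_shift I r c l : sorted time_le ((r, c) :: l) ->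
  cylinder_in I ((r, c) :: l) -> (0 <= r)%R ->
  exists l', [/\ sorted time_le l', size l' = size l,
    cylinder_in [set u | 0 <= u /\ I (r + u)]%R l' &
    cylinder l = theta r @^-1` cylinder l'].
Proof.
move=> rl /= /andP[_ lI] r0.
have rle p : p \in l -> (r <= p.1)%R.
  have /order_path_min : transitive time_le by move=> ? ? ?; exact: le_trans.
  by move=> /(_ _ _ rl)/allP => /(_ p).
exists (map (fun p => (p.1 - r, p.2)%R) l); split.
- rewrite sorted_map; apply: sub_sorted (path_sorted rl) => p q.
  by rewrite /time_le/= lerD2r.
- by rewrite size_map.
- rewrite /cylinder_in all_map; apply/allP => p pl /=.
  move/allP : lI => /(_ p pl)/asboolP[Ip mp]; apply/asboolP => /=.
  by rewrite subr_ge0 rle// addrC subrK.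
- apply/seteqP; split => w; rewrite /cylinder/= all_map => /allP lw;
  apply/allP => p pl;
    move: (lw _ pl) => /=; rewrite theta_X ?subr_ge0 ?rle//.
    by rewrite addrC subrK.
  by rewrite addrC subrK.
Qed.

Lemma past_measurable t : past t `<=` measurable.
Proof. by apply: sigma_gen_measurable => s /=; rewrite in_itv/= => /andP[]. Qed.
Arguments past_measurable {t}.

Lemma past_sub_G t : past t `<=` G.
Proof. by apply: sub_sigma_gen => s /=; rewrite !in_itv/= andbT => /andP[]. Qed.

Lemma past_sub s t : (s <= t)%R -> past s `<=` past t.
Proof.
move=> st; apply: sub_sigma_gen => r /=; rewrite !in_itv/= => /andP[-> /= rs].
exact: le_trans st.
Qed.

Lemma past_evt s t (b : set (borel E)) : (0 <= s)%R -> (s <= t)%R ->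
  measurable b -> past t (evt s b).
Proof. by move=> s0 st mb; apply: sigma_gen_evt => //=; rewrite in_itv/=
  s0. Qed.

Lemma past_setI t A B : past t A -> past t B -> past t (A `&` B).
Proof.
move=> HA HB; rewrite -(setCK (A `&` B)) setCI.
apply: sigma_algebraC; rewrite -bigcup2E;
  apply: sigma_algebra_bigcup => -[|[|i]].
- exact: sigma_algebraC.
- exact: sigma_algebraC.
- exact: sigma_algebra0.
Qed.

Lemma G_setI A B : G A -> G B -> G (A `&` B).
Proof.
by move=> GA GB; move: (@measurableI _ GOmega A B); rewrite !measurable_GE;
  apply.
Qed.

Lemma measurable_Px_XG t B : (0 <= t)%R -> G B ->
  measurable_fun setT (fun w : GOmega => Px (X t w) B).
Proof.
move=> t0 GB; apply: measurableT_comp (measurable_Px _ GB) _.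
by move=> _ b mb; rewrite setTI measurable_GE; exact: G_evt.
Qed.

(** As functions of [A], both sides are finite measures, and they agree on the pi-system of
    cylinders that generates the past. *)
Lemma markov_at_past t B : (0 <= t)%R -> G B ->
  (forall l, cylinder_in `[0%R, t] l -> markov_at (cylinder l) t B) ->
  forall A, past t A -> markov_at A t B.
Proof.
move=> t0 GB cylB A HA; rewrite /markov_at.
have mtB : measurable (theta t @^-1` B) by apply: G_measurable; exact: G_shift.
have mid : measurable_fun setT
    (id : Omega -> g_sigma_algebraType (cylinder @` cylinder_in `[0%R, t])).
  by move=> _ b; rewrite /measurable/= -sigma_genE setTI preimage_id => Hb;
    exact: past_measurable _ Hb.
rewrite setIC -[LHS]mul1e -integral_cst; last first.
  by apply: measurableI => //; exact: past_measurable _ HA.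
rewrite -[X in \int[P]_(w in X) Px _ _]setTI.
apply: (@eq_integral_pi_system _ _ _ _ _ Omega (cylinder @` cylinder_in `[0%R,
  t])
  P P (theta t @^-1` B) setT mtB measurableT (cst 1) (fun w => Px (X t w) B)
  _ _ _ _ _ _ _ id id mid mid) => //.
- exact: measurable_Px_X.
- by rewrite integral_cst// mul1e (le_lt_trans (probability_le1 P mtB))// ltry.
- exact: cylinder_setI.
- exact: cylinder_setT.
- move=> _ [l lI <-]; rewrite setTI preimage_id integral_cst ?mul1e; last first.
    by apply: measurableI => //; apply: (@past_measurable t);
      exact: cylinder_sigma_gen.
  by rewrite setIC; exact: cylB.
- by rewrite -sigma_genE.
Qed.

(** Induction on the number of times. The earliest time [r] and time 0 form a pair event A', and the
    hypothesis at [r] turns the process after [r] into one started from a reweighted law. The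
    remaining times form a shorter cylinder on [0, t - r]. *)
Lemma markov_at_cylinder :
  (forall t (c0 c1 : set (borel E)) B, (0 <= t)%R -> measurable c0 ->
    measurable c1 ->
    G B -> markov_at (evt 0 c0 `&` evt t c1) t B) ->
  forall t A B, (0 <= t)%R -> past t A -> G B -> markov_at A t B.
Proof.
move=> pair t A B t0 HA GB; apply: (markov_at_past t B) => //.
apply: (cylinder_sorted_ind _ (fun A => markov_at A t B)) => l sl lI.
(* The extra set [c0] constrains X_0: it is the whole space at the end, but in the induction it
   absorbs the test sets for the weight rho(X_0). The time varies because [t] becomes [t - r]. *)
suff /(_ _ _ _ _ _ (ltnSn _) t0 measurableT GB sl lI) : forall n l t B (c0 :
  set (borel E)),
    (size l < n)%N -> (0 <= t)%R -> measurable c0 -> G B -> sorted time_le l ->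
    cylinder_in `[0%R, t] l -> markov_at (evt 0 c0 `&` cylinder l) t B.
  by rewrite preimage_setT setTI.
elim=> // n IH {A HA l sl lI}l {t0}t {GB}B c0 ln t0 mc0 GB sl lI.
case: l sl lI ln => [|[r c] l].
  by rewrite cylinder_nil => _ _ _; rewrite -(preimage_setT (X t : Omega ->
    borel E)); exact: pair.
move=> sl lI; rewrite ltnS => ln.
move: (lI) => /= /andP[/asboolP[/=]]; rewrite in_itv/= => /andP[r0 rt] mc _.
have [l' [sl' szl' l'I lE]] := cylinder_shift _ _ _ _ sl lI r0.
have T0 : (0 <= t - r)%R by rewrite subr_ge0.
have {}l'I : cylinder_in `[0%R, (t - r)%R]%classic l'.
  apply: sub_all l'I => p /asboolP[[p0]]; rewrite /= in_itv/=
    => /andP[_ prt] mp.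
  by apply/asboolP; split => //=; rewrite in_itv/= p0 lerBrDl.
pose A' := evt 0 c0 `&` evt r c.
have mA' : measurable A' by apply: measurableI; exact: measurable_evt.
have GA'' : G (cylinder l') by apply: past_sub_G; exact: cylinder_sigma_gen l'I.
have [rho [mrho rho0 rhoE]] := past_density A' r mA' r0.
have A'rho B' : G B' -> P (A' `&` theta r @^-1` B') =
  \int[P]_(w in B') rho (X 0 w).
  by move=> GB'; rewrite -(past_integral A' r rho)//; exact: pair.
have mrho0 : measurable_fun setT (fun w => rho (X 0 w)).
  by apply: measurableT_comp mrho _; exact: mX.
rewrite cylinder_cons lE setIA -/A' /markov_at.
have -> : theta t @^-1` B = theta r @^-1` (theta (t - r) @^-1` B).
  by rewrite shift_shift// addrC subrK.
have GTB : G (theta (t - r) @^-1` B) by exact: G_shift.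
rewrite -setIA -preimage_setI A'rho; last exact: G_setI.
rewrite (@eq_measure_integral_comp _ _ _ (borel E) P
   (cylinder l' `&` theta (t - r) @^-1` B) (cylinder l')
   (fun w => Px (X (t - r) w) B) (X 0) (X 0) rho)//; first last.
(* Testing against X_0 in [b] is the induction hypothesis for [l'] with [b] as the set [c0]. *)
- move=> b mb; rewrite setIC setIA (setIC _ (evt 0 b)).
  by apply: IH => //; rewrite szl'.
- exact: mX.
- exact: mX.
- exact: measurable_Px_X.
- exact: G_measurable.
- by apply: G_measurable; exact: G_setI.
under eq_integral do rewrite muleC.
transitivity (\int[P]_(w in A' `&` theta r @^-1` cylinder l')
    Px (X (t - r)%R (theta r w)) B); last first.
  by apply: eq_integral => w _; rewrite theta_X// addrC subrK.
(* The reweighting is undone: [A'rho] turns the weight rho(X_0) on [cylinder l'] back into the event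
   A' followed by the shift by [r]. *)
apply/esym; apply: (@eq_measure_integral_comp _ _ _ GOmega P
   (A' `&` theta r @^-1` cylinder l') (cylinder l')
   (fun w => rho (X 0 w)) (theta r) id (fun w => Px (X (t - r) w) B)) => //.
- by apply: measurableI => //; apply: G_measurable; exact: G_shift.
- exact: G_measurable.
- exact: measurable_shift.
- exact: measurable_idG.
- exact: measurable_Px_XG.
- move=> b; rewrite measurable_GE => Gb;
  rewrite preimage_id -setIA -preimage_setI A'rho//.
  exact: G_setI.
Qed.

(** Induction on the number of future times: the constraint at the first time [s + r] is moved into
    the past, which is why the time and the past event vary in the induction. *)
Lemma markov_at_future :
  (forall s r (b : set (borel E)) A, (0 <= s)%R -> (0 <= r)%R -> measurable b ->
    past s A -> markov_at A s (evt r b)) ->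
  forall s A B, (0 <= s)%R -> past s A -> G B -> markov_at A s B.
Proof.
move=> markov1 s A B s0 HA GB.
have mA : measurable A := past_measurable _ HA.
have [rho [mrho rho0 rhoE]] := past_density A s mA s0.
have mrho0 : measurable_fun setT (fun w => rho (X 0 w)).
  by apply: measurableT_comp mrho _; exact: mX.
suff cyl : forall l, cylinder_in `[0%R, +oo[%classic l ->
  markov_at A s (cylinder l).
  have mid : measurable_fun setT
      (id : Omega -> g_sigma_algebraType (cylinder @` cylinder_in `[0%R,
        +oo[%classic)).
    by move=> _ b; rewrite /measurable/= -sigma_genE setTI preimage_id;
      exact: G_measurable.
  have mth : measurable_fun setT
      (theta s : Omega -> g_sigma_algebraType (cylinder @` cylinder_in `[0%R,
        +oo[%classic)).
    move=> _ b; rewrite /measurable/= -sigma_genE setTI => Gb.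
    by apply: G_measurable; exact: G_shift.
  rewrite /markov_at (past_integral A s rho)// -[LHS]mul1e -integral_cst;
    last first.
    by apply: measurableI => //; apply: G_measurable; exact: G_shift.
  rewrite -[X in \int[P]_(w in X) rho _]setTI.
  apply: (@eq_integral_pi_system _ _ _ _ _ Omega (cylinder @` cylinder_in
    `[0%R, +oo[%classic)
    P P A setT mA measurableT (cst 1) (fun w => rho (X 0 w))
    _ _ _ _ _ _ _ (theta s) id mth mid) => //.
  - by rewrite integral_cst// mul1e (le_lt_trans (probability_le1 P mA))// ltry.
  - exact: cylinder_setI.
  - exact: cylinder_setT.
  - move=> _ [l lI <-]; have Gl := cylinder_sigma_gen _ _ lI.
    rewrite setTI preimage_id integral_cst ?mul1e; last first.
      by apply: measurableI => //; apply: G_measurable; exact: G_shift.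
    by rewrite -(past_integral A s rho)//; exact: cyl.
  - by rewrite -sigma_genE.
apply: (cylinder_sorted_ind _ (fun B => markov_at A s B)) => l sl lI.
suff /(_ _ _ _ _ (ltnSn _) s0 HA sl lI) : forall n l s A,
    (size l < n)%N -> (0 <= s)%R -> past s A -> sorted time_le l ->
    cylinder_in `[0%R, +oo[%classic l -> markov_at A s (cylinder l) by [].
elim=> // n IH {B GB l sl lI rho mrho rho0 rhoE mrho0 mA HA s0}l {}s {}A ln s0
  HA sl lI.
have mA : measurable A := past_measurable _ HA.
case: l sl lI ln => [|[r c] l].
  rewrite cylinder_nil => _ _ _; rewrite /markov_at preimage_setT setIT.
  under eq_integral do rewrite prob_kernel.
  by rewrite integral_cst// mul1e.
move=> sl lI; rewrite ltnS => ln.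
move: (lI) => /= /andP[/asboolP[/=]]; rewrite in_itv/= andbT => r0 mc _.
have [l' [sl' szl' l'I lE]] := cylinder_shift _ _ _ _ sl lI r0.
have {}l'I : cylinder_in `[0%R, +oo[%classic l'.
  apply: sub_all l'I => p /asboolP[[p0 _ mp]].
  by apply/asboolP; split => //=; rewrite in_itv/= p0.
have Gl' : G (cylinder l') by exact: cylinder_sigma_gen l'I.
have [rho [mrho rho0 rhoE]] := past_density A s mA s0.
have mrho0 : measurable_fun setT (fun w => rho (X 0 w)).
  by apply: measurableT_comp mrho _; exact: mX.
have sr0 : (0 <= s + r)%R by exact: addr_ge0.
have GB' : G (evt r c `&` theta r @^-1` cylinder l').
  by apply: G_setI; [exact: G_evt|exact: G_shift].
have mrc : measurable (evt r c) by exact: measurable_evt.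
rewrite cylinder_cons lE /markov_at (past_integral A s rho)//.
rewrite preimage_setI shift_evt// shift_shift// setIA.
have HAc : past (s + r)%R (A `&` evt (s + r)%R c).
  apply: past_setI; last exact: past_evt.
  by apply: past_sub HA; rewrite lerDl.
(* The induction hypothesis is used twice: here at time [s + r], and at the end at time [r], where
   the past event constrains X_r and X_0. *)
rewrite [LHS](IH l' (s + r)%R (A `&` evt (s + r)%R c))//; last by rewrite szl'.
rewrite (@eq_measure_integral_comp _ _ _ (borel E) P
   (A `&` evt (s + r)%R c) (evt r c)
   (fun w => rho (X 0 w)) (X (s + r)%R) (X r) (fun x => Px x (cylinder l')))//;
     first last.
(* The one-time hypothesis identifies the law of X_{s+r} on [A] with that of X_r under the initial
   weight [rho]. *)
- move=> b mb; rewrite -setIA -preimage_setI.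
  have mcb : measurable (c `&` b) by exact: measurableI.
  by rewrite -shift_evt// markov1// (past_integral A s rho)//; exact: G_evt.
- exact: measurable_Px.
- exact: mX.
- exact: mX.
- exact: past_measurable _ HAc.
apply/esym; under [RHS]eq_integral do rewrite muleC.
apply: (@eq_measure_integral_comp _ _ _ (borel E) P
   (evt r c `&` theta r @^-1` cylinder l') (evt r c)
   (fun w => Px (X r w) (cylinder l')) (X 0) (X 0) rho) => //.
- exact: G_measurable.
- exact: measurable_Px_X.
- exact: mX.
- exact: mX.
- move=> b mb; rewrite setIAC.
  have Hrb : past r (evt r c `&` evt 0 b).
    by apply: past_setI; exact: past_evt.
  by apply: (IH l' r (evt r c `&` evt 0 b)) => //; rewrite szl'.
Qed.
(** * Augmentation and limits from the right *)

Lemma evolution_cvg s x : (0 <= s)%R ->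
  (exp_evolution F (s + n.+1%:R^-1) x @[n --> \oo] --> exp_evolution F s x)%R.
Proof.
move=> s0; case: foed_X => _ /(_ x) iF _.
apply: continuous_cvg; first exact: continuous_expR.
(* [s + 1] bounds all the upper limits, as 1/(n+1) <= 1; on this fixed interval |F| dominates the
   restricted integrands. *)
have s10 : (0 <= s + 1)%R by rewrite addr_ge0.
have intF := iF _ s10.
pose f (u : R) := (F u x)%:E.
have IE (r : R) : (0 <= r)%R -> (r <= s + 1)%R ->
    (\int[lebesgue_measure]_(u in `[0, r]) F u x)%R =
    fine (\int[lebesgue_measure]_(u in `[0%R, (s + 1)%R]) (f \_ `[0%R, r]) u).
  move=> r0 r1; rewrite /Rintegral -integral_mkcondr;
    congr (fine (integral _ _ _)).
  apply/seteqP; split => u /=; rewrite !in_itv/=; last by case.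
  by move=> /andP[-> ur]; rewrite (le_trans ur).
have inv1 n : (n.+1%:R^-1 <= 1 :> R)%R by rewrite invf_le1// ler1n.
rewrite IE ?lerDl//.
under eq_fun do rewrite IE ?lerD2l ?addr_ge0//.
have mf : measurable_fun `[0%R, (s + 1)%R] f := measurable_int _ intF.
have mfr (r : R) : measurable_fun `[0%R, (s + 1)%R] (f \_ `[0%R, r]).
  apply/measurable_restrict => //.
  by apply: measurable_funS mf => // u [].
have := @dominated_convergence _ _ _ lebesgue_measure `[0%R,
  (s + 1)%R]%classic _
  (fun n => f \_ `[0%R, (s + n.+1%:R^-1)%R]) (f \_ `[0%R, s]) (fun u => `|f u|).
case => //.
- by move=> n; exact: mfr.
- exact: mfr.
- apply: aeW => u; rewrite /= in_itv/= => /andP[ug0 _].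
  have [us|su] := leP u s.
    apply: cvg_near_cst; apply: nearW => n; rewrite !patchE !mem_set//=
      in_itv/= ug0//=.
    by rewrite (le_trans us)// lerDl.
  have su0 : (0 < u - s)%R by rewrite subr_gt0.
  apply: cvg_near_cst; near=> n; rewrite !patchE !memNset//=; rewrite in_itv/=
    ug0/=.
  + by apply/negP; rewrite -ltNge.
  + apply/negP; rewrite -ltNge -ltrBrDl; near: n.
    exact: (near_infty_natSinv_lt (PosNum su0)).
- exact: integrable_abse.
- apply: aeW => u n _; rewrite patchE; case: ifPn => // _.
  by rewrite abse0.
- move=> intfs _ cvgI; apply: fine_cvg; rewrite fineK//.
  exact: integrable_fin_num.
Unshelve. all: by end_near. Qed.

(* Scheffe's argument: the truncated densities min(e_u, e_s) converge by dominated
   convergence, and they bound P(X_u in C) from below and, through the complement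
   of C, from above. *)
Lemma law_cvg s (C : set (borel E)) : (0 <= s)%R -> measurable C ->
  P (evt (s + n.+1%:R^-1)%R C) @[n --> \oo] --> P (evt s C).
Proof.
move=> s0 mC.
pose u n := (s + n.+1%:R^-1)%R.
have u0 n : (0 <= u n)%R by rewrite addr_ge0.
pose m n (D : set (borel E)) :=
  \int[P]_(w in evt 0 D) Order.min (e (u n) (X 0 w)) (e s (X 0 w)).
have mev t : measurable_fun setT (fun w => e t (X 0 w)).
  by apply: measurableT_comp (measurable_exp_evolution t) _; exact: mX.
have m_cvg D : measurable D -> m n D @[n --> \oo] --> P (evt s D).
  move=> mD; rewrite (foed_measure s D)//.
  have mD0 : measurable (evt 0 D) by exact: measurable_evt.
  have [] // := @dominated_convergence _ _ _ P (evt 0 D) mD0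
    (fun n w => Order.min (e (u n) (X 0 w)) (e s (X 0 w))) (fun w => e s (X 0
      w))
    (fun w => e s (X 0 w)).
  - by move=> n; apply: measurable_mine; exact: measurable_funTS.
  - exact: measurable_funTS.
  - apply: aeW => w _.
    under eq_fun do rewrite -EFin_min.
    apply: cvg_EFin; first exact: nearW.
    by apply: cvg_minr; exact: evolution_cvg.
  - apply/integrableP; split; first exact: measurable_funTS.
    under eq_integral do rewrite gee0_abs ?exp_evolution_ge0//.
    by rewrite -foed_measure// (le_lt_trans (probability_le1 _ _))// ?ltry//;
      exact: measurable_evt.
  - apply: aeW => w n _; rewrite gee0_abs; first by rewrite ge_min lexx orbT.
    by rewrite le_min !exp_evolution_ge0.
have m_le n D : measurable D -> m n D <= P (evt (u n) D).
  move=> mD; rewrite (foed_measure (u n) D)//; apply: ge0_le_integral => //.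
  - exact: measurable_evt.
  - by move=> w _; rewrite le_min !exp_evolution_ge0.
  - by apply: measurable_mine; exact: measurable_funTS.
  - exact: measurable_funTS (mev _).
  - by move=> w _; rewrite ge_min lexx.
have PC t : (0 <= t)%R -> P (evt t C) = 1 - P (evt t (~` C)).
  move=> t0; rewrite preimage_setC probability_setC; last exact: measurable_evt.
  have mC' : measurable (evt t C) by exact: measurable_evt.
  rewrite -[X in X = 1 - (1 - X)]fineK ?fin_num_measure// -!EFinB.
  by congr EFin; rewrite subKr.
apply: (@squeeze_cvge _ _ _ _ (m ^~ C) _ (fun n => 1 - m n (~` C))).
- apply: nearW => n; apply/andP; split; first exact: m_le.
  rewrite -/(u n) PC//; apply: leeD => //; rewrite leeN2.
  by apply: m_le; exact: measurableC.
- exact: m_cvg.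
- rewrite PC//; apply: cvgeB.
  + exact: fin_num_adde_defr.
  + exact: cvg_cst.
  + by apply: m_cvg; exact: measurableC.
Qed.
Local Notation nulls := (null_sets P X).

(** The sets that agree with an event of [sigma_gen X I] off a null event form a sigma-algebra. The
    null event is kept in the raw sigma-algebra of [X], so that it can be shifted, but it need not
    lie in [sigma_gen X I]. *)
Lemma completion_approx (I : set R) A : (forall t, I t -> 0 <= t)%R ->
  <<s sigma_gen X I `|` nulls >> A ->
  exists A' N, [/\ sigma_gen X I A', G N, P N = 0 & A `\` N = A' `\` N].
Proof.
move=> I0; move: A; have G0 : G set0 by exact: sigma_algebra0.
have P0 : P set0 = 0 by exact: measure0.
apply: smallest_sub; first split.
- by exists set0, set0; split => //; exact: sigma_algebra0.
- move=> A [A' [N [HA' GN PN AA']]]; exists (~` A'), N; split => //.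
    exact: sigma_algebraC.
  rewrite setTD; apply/seteqP; split => w [nA nN]; split => // Aw; apply: nA.
    by have [] : (A `\` N) w by rewrite AA'.
  by have [] : (A' `\` N) w by rewrite -AA'.
- move=> A AA; have [A' /choice[N AN]] := choice AA.
  exists (\bigcup_k A' k), (\bigcup_k N k); split.
  + by apply: sigma_algebra_bigcup => k; have [] := AN k.
  + by apply: sigma_algebra_bigcup => k; have [] := AN k.
  + have mN k : measurable (N k) by apply: G_measurable; have [] := AN k.
    apply/negligibleP; first exact: bigcup_measurable.
    by apply: negligible_bigcup => k; apply/negligibleP => //; have [] := AN k.
  + apply/seteqP; split => w [[k _ Ak] nN]; split => //; exists k => //.
      have [] // : (A' k `\` N k) w; have [_ _ _ <-] := AN k.
      by split => // Nk; apply: nN; exists k.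
    have [] // : (A k `\` N k) w; have [_ _ _ ->] := AN k.
    by split => // Nk; apply: nN; exists k.
- move=> A [HA|[N [GN PN AN]]]; first by exists A, set0; split.
  exists set0, N; split => //; first exact: sigma_algebra0.
  by rewrite set0D; apply/seteqP; split => // w [/AN].
Qed.

Hypothesis complete_P : measure_is_complete P.

(** The part of [A] inside [N] is negligible, hence measurable by completeness of [P]. *)
Lemma measurable_of_ae_eq A A' N : measurable A' -> measurable N -> P N = 0 ->
  A `\` N = A' `\` N -> measurable A.
Proof.
move=> mA' mN PN AA'; rewrite -(setDUK (@subIsetl _ A N)) setDIr setDv set0U
  AA'.
apply: measurableU; last exact: measurableD.
apply: complete_P; exists N; split => //; exact: subIsetr.
Qed.

Lemma integral_ae_eq_set A A' N (f : Omega -> \bar R) :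
  measurable A -> measurable A' -> measurable N -> P N = 0 ->
  A `\` N = A' `\` N -> measurable_fun setT f -> (forall w, 0 <= f w) ->
  \int[P]_(w in A) f w = \int[P]_(w in A') f w.
Proof.
move=> mA mA' mN PN AA' mf f0.
rewrite (ge0_negligible_integral mN mA)//; last exact: measurable_funTS.
by rewrite AA' -(ge0_negligible_integral mN mA')//; exact: measurable_funTS.
Qed.

Lemma measure_ae_eq_set A A' N B :
  measurable A -> measurable A' -> measurable N -> P N = 0 ->
  A `\` N = A' `\` N -> measurable B -> P (A `&` B) = P (A' `&` B).
Proof.
move=> mA mA' mN PN AA' mB.
rewrite -[LHS]mul1e -[RHS]mul1e -!integral_cst; try exact: measurableI.
apply: (integral_ae_eq_set _ _ N) => //; try exact: measurableI.
by rewrite setIC -setIDA AA' setIDA setIC.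
Qed.

(** The intersection defining the filtration starts strictly after [s], so the raw past is reached
    only at times beyond [s]. *)
Lemma filtration_approx s t D : (s < t)%R -> (0 <= t)%R -> filtration P X s D ->
  exists D' N, [/\ past t D', G N, P N = 0 & D `\` N = D' `\` N].
Proof.
move=> st t0 /(_ t) Dt; apply: completion_approx.
  by move=> r /=; rewrite in_itv/= => /andP[].
by apply: Dt; rewrite /= in_itv/= st.
Qed.

Lemma filtration_measurable s D : (0 <= s)%R -> filtration P X s D ->
  measurable D.
Proof.
move=> s0 Ds; have s1 : (s < s + 1)%R by rewrite ltrDl.
have [D' [N [HD' GN PN DD']]] :=
  filtration_approx _ _ _ s1 (le_trans s0 (ltW s1)) Ds.
apply: (measurable_of_ae_eq _ _ _ _ _ PN DD'); last exact: G_measurable.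
exact: past_measurable HD'.
Qed.

Lemma past_filtration s D : past s D -> filtration P X s D.
Proof.
move=> HD t /=; rewrite in_itv/= andbT => st; apply: sub_gen_smallest; left.
exact: (past_sub _ _ (ltW st)).
Qed.

Hypothesis cadlag_X : cadlag X.

Lemma cvg_right_path s w : (0 <= s)%R -> X (s + n.+1%:R^-1) w @[n --> \oo] -->
  X s w.
Proof.
move=> s0; have [/(_ s s0) Xs _] := cadlag_X w.
apply: (cvg_comp (fun n => (s + n.+1%:R^-1)%R) (X ^~ w) _ Xs) => V /= sV.
have : (s + n.+1%:R^-1)%R @[n --> \oo] --> s.
  rewrite -[X in _ --> X]addr0; apply: cvgD; first exact: cvg_cst.
  exact: cvg_harmonic.
move=> /(_ _ sV)[N _ HN]; exists N => // n Nn; apply: (HN n Nn).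
by rewrite ltrDl.
Qed.

Lemma cvg_event s D (b : set (borel E)) : (0 <= s)%R -> measurable D ->
  measurable b ->
  P (D `&` evt (s + n.+1%:R^-1)%R b) @[n --> \oo] --> P (D `&` evt s b).
Proof.
move=> s0 mD mb.
have sn0 n : (0 <= s + n.+1%:R^-1)%R by rewrite addr_ge0.
apply: (cvg_setwise P (fun n => X (s + n.+1%:R^-1)%R) (X s)) => //.
- by move=> n; exact: mX.
- exact: mX.
- by move=> w; exact: cvg_right_path.
- by move=> C mC; exact: law_cvg.
Qed.

(* The filtration is right-continuous while [markov_at] concerns the raw past, so
   the Markov property at time s is a limit along s + 1/(n+1). Setwise convergence
   gives only an inequality, but it holds for A and for its complement, and both
   sides add up to P(D). *)
Lemma markov_process_of_markov_at :
  (forall t A B, (0 <= t)%R -> past t A -> G B -> markov_at A t B) ->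
  markov_process P X Px.
Proof.
move=> markov s t s0 st A mA; pose r := (t - s)%R.
have r0 : (0 <= r)%R by rewrite subr_ge0.
have Gr b : measurable b -> G (evt r b) by move=> mb; exact: G_evt.
have srt : (s + r = t)%R by rewrite addrC subrK.
split.
  move=> B mB; apply: past_filtration.
  have := measurable_Px _ (Gr A mA) measurableT B mB; rewrite setTI => mPB.
  exact: (past_evt s s _ s0 (lexx s) mPB).
move=> D Ds; have mD := filtration_measurable _ _ s0 Ds.
have le_markov b : measurable b ->
    \int[P]_(w in D) Px (X s w) (evt r b) <= P (D `&` evt t b).
  move=> mb; pose u n := (s + n.+1%:R^-1)%R.
  have u0 n : (0 <= u n)%R by rewrite addr_ge0.
  apply: (@setwise_fatou _ _ _ _ (borel E) P (fun n => X (u n)) (X s) _ _ D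
    (fun x => Px x (evt r b))) => //.
  - by move=> n; exact: mX.
  - exact: mX.
  - by apply: measurable_Px; exact: Gr.
  - by move=> c mc; exact: cvg_event.
  - have t0 : (0 <= t)%R by rewrite (le_trans s0).
    apply: cvg_trans (cvg_event t D b t0 mD mb); apply: near_eq_cvg.
    apply: nearW => n; have sun : (s < u n)%R by rewrite ltrDl.
    (* As [u n > s], the event [D] agrees off a null event with one of the raw past of [u n]. The
       hypothesis there concerns the time u n + r = t + 1/(n+1), so the probabilities converge to
       the one at [t]. *)
    have [D' [N [HD' GN PN DD']]] := filtration_approx _ _ _ sun (u0 n) Ds.
    have mD' := past_measurable _ HD'; have mN := G_measurable _ GN.
    rewrite (integral_ae_eq_set D D' N)//; last first.
      by apply: measurable_Px_X => //; exact: Gr.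
    rewrite -(markov (u n) D' (evt r b))//; last exact: Gr.
    rewrite shift_evt// /u addrAC srt.
    rewrite (measure_ae_eq_set D D' N)//; apply: measurable_evt => //.
    by rewrite addr_ge0.
have t0 : (0 <= t)%R by rewrite (le_trans s0).
have mDA b : measurable b -> measurable (D `&` evt t b).
  by move=> mb; apply: measurableI => //; exact: measurable_evt.
have mCA : measurable (~` A : set (borel E)) by exact: measurableC.
have sum_P : P (D `&` evt t A) + P (D `&` evt t (~` A)) = P D.
  by rewrite addeC [RHS](measureDI _ mD (measurable_evt t A t0 mA)).
have sum_I : \int[P]_(w in D) Px (X s w) (evt r A) +
    \int[P]_(w in D) Px (X s w) (evt r (~` A)) = P D.
  rewrite -ge0_integralD//; last 2 first.
  - by apply/measurable_funTS/measurable_Px_X => //; exact: Gr.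
  - by apply/measurable_funTS/measurable_Px_X => //; exact: Gr.
  rewrite -[RHS]mul1e -integral_cst//; apply: eq_integral => w _.
  rewrite -measureU ?measurable_GE; [|exact: Gr|exact: Gr|].
    by rewrite -[evt r (~` A)]/(~` evt r A) setUv; exact: (prob_kernel (s :=
      Px) (X s w)).
  by rewrite -[evt r (~` A)]/(~` evt r A) setICr.
have -> : \int[P]_(w in D) (\1_(X t @^-1` A) w)%:E = P (D `&` evt t A).
  by rewrite integral_indic// 1?setIC//; exact: measurable_evt.
have [le1 le2] := (le_markov _ mA, le_markov _ mCA).
apply/eqP; rewrite eq_le le1/= leNgt; apply/negP => lt1.
suff : P D < P D by rewrite ltxx.
rewrite -[X in X < _]sum_I -sum_P; apply: lte_leD => //.
by rewrite ge0_fin_numE ?integral_ge0// (le_lt_trans le2)// -ge0_fin_numE//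
  fin_num_measure//; exact: mDA.
Qed.

(** * From the shift property to pairs of times *)

Lemma G_filtration_oo : G `<=` filtration_oo P X.
Proof.
apply: smallest_sub; first exact: smallest_sigma_algebra.
move=> A [t /=]; rewrite in_itv/= andbT => t0 [b mb <-{A}]; rewrite setTI.
apply: sub_gen_smallest; exists t; first by rewrite /= in_itv/= t0.
by apply: past_filtration; exact: past_evt.
Qed.

Lemma indic_filtration_oo B : G B ->
  measurable_wrt (filtration_oo P X) (\1_B : Omega -> R).
Proof.
move=> GB C mC; have FB := G_filtration_oo _ GB.
have F0 : filtration_oo P X set0 by exact: sigma_algebra0.
rewrite preimage_indic; case: ifP => _; case: ifP => _ //.
- by rewrite -setC0; exact: sigma_algebraC.
- exact: sigma_algebraC.
Qed.

Lemma integral_indicM (D : set Omega) (f : Omega -> R) :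
  \int[P]_w (\1_D w * f w)%:E = \int[P]_(w in D) (f w)%:E.
Proof.
rewrite [RHS]integral_mkcond; apply: eq_integral => w _.
by rewrite patchE indicE; case: ifPn => _; rewrite ?mul1r// mul0r.
Qed.

(** The right side is also what the first identity of the shift property yields for [B] intersected
    with X_0 in [b]. Hence that identity makes x |-> P_x(B) a version of P(theta_t^-1 B | X_t =
    x). *)
Lemma regular_evolution_integral t B (b : set (borel E)) : (0 <= t)%R -> G B ->
  measurable b ->
  \int[P]_(w in evt t b) Px (X t w) B =
    \int[P]_(w in B `&` evt 0 b) e t (X 0 w).
Proof.
move=> t0 GB mb; have mB := G_measurable _ GB.
rewrite (foed_integral t b (fun x => Px x B))//; last exact: measurable_Px.
under eq_integral do rewrite muleC.
apply/esym/(@eq_measure_integral_comp _ _ _ (borel E) P (B `&` evt 0 b) (evt 0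
  b)
  (fun w => Px (X 0 w) B) (X 0) (X 0) (fun x => e t x)) => //.
- by apply: measurableI => //; exact: measurable_evt.
- exact: measurable_evt.
- exact: measurable_Px_X.
- exact: mX.
- exact: mX.
- exact: measurable_exp_evolution.
- by move=> x; exact: exp_evolution_ge0.
- move=> b' mb'; rewrite -setIA.
  by apply: (regular_measure B (b `&` b')) => //; exact: measurableI.
Qed.

(** The test variable is the indicator of [B]. The Radon-Nikodym version [g] given (X_t, X_0) and
    the version P_x(B) given X_t agree almost everywhere by the second identity, and [g] integrates
    correctly over pair events. *)
Lemma markov_at_pair_of_shift_property : shift_property P X theta F ->
  forall t (c0 c1 : set (borel E)) B, (0 <= t)%R -> measurable c0 ->
    measurable c1 ->
    G B -> markov_at (evt 0 c0 `&` evt t c1) t B.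
Proof.
move=> shiftP t c0 c1 B; rewrite le_eqVlt => /predU1P[<- mc0 mc1 GB|t0 mc0 mc1
  GB].
  (* The shift property concerns positive times only; at time 0 the claim is the defining property
     of [Px]. *)
  rewrite /markov_at shift0// setIC.
  by apply: (regular_measure B (c0 `&` c1)) => //; exact: measurableI.
have tge0 := ltW t0.
have ind_ge0 (D : set Omega) (w : Omega) : (0 <= \1_D w :> R)%R by [].
have shift_meas D : G D -> P (theta t @^-1` D) = \int[P]_(w in D) e t (X 0 w).
  move=> GD; have [+ _] := shiftP _ (indic_filtration_oo D GD) (or_introl
    (ind_ge0 D)) t t0.
  rewrite !expectationE integral_indicM => <-.
  transitivity (\int[P]_w (\1_(theta t @^-1` D) w)%:E) => //.
  by rewrite integral_indic ?setIT//; apply: G_measurable; exact: G_shift.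
have mtB : measurable (theta t @^-1` B) by apply: G_measurable; exact: G_shift.
pose Y w : borel E * borel E := (X t w, X 0 w).
have mY : measurable_fun setT Y by apply: measurable_fun_pair; exact: mX.
have mYb b : measurable b -> measurable (Y @^-1` b).
  by move=> mb; rewrite -[X in measurable X]setTI; apply: mY.
have [g [mg g0 gE]] := density_along P _ _ mY mtB.
have intB D : measurable D ->
    \int[P]_(w in D) (\1_B (theta t w))%:E = P (theta t @^-1` B `&` D).
  move=> mD; transitivity (\int[P]_(w in D) (\1_(theta t @^-1` B) w)%:E) => //.
  by rewrite integral_indic.
have [_ /(_ g (fun x => Px x B))] :=
  shiftP _ (indic_filtration_oo B GB) (or_introl (ind_ge0 B)) t t0.
case=> //.
- split=> //; split.
    move=> C mC; exists (g @^-1` C); last by rewrite setTI.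
    by rewrite -[X in measurable X]setTI; apply: mg.
  by move=> _ [b mb <-]; rewrite setTI intB//; [rewrite gE|exact: mYb].
- split; first exact: measurable_Px; split.
    move=> C mC; exists ((fun x : borel E => Px x B) @^-1` C);
      last by rewrite setTI.
    by rewrite -[X in measurable X]setTI; apply: (measurable_Px _ GB).
  move=> _ [b mb <-]; rewrite setTI intB//; last exact: measurable_evt.
  (* The first identity is applied to [B] intersected with X_0 in [b], whose preimage under the
     shift is theta_t^-1(B) intersected with X_t in [b]. *)
  rewrite regular_evolution_integral// -shift_meas; last first.
    by apply: G_setI => //; exact: G_evt.
  by rewrite preimage_setI shift_evt// addr0.
move=> N [mN PN gN].
pose c : set (borel E * borel E) := c1 `*` c0.
have mc : measurable c by exact: measurableX.
rewrite /markov_at setIC.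
rewrite (_ : evt 0 c0 `&` evt t c1 = Y @^-1` c); last first.
  by apply/seteqP; split => w [].
rewrite gE//; apply: ge0_ae_eq_integral => //.
- exact: mYb.
- by apply/measurable_funTS; exact: measurableT_comp.
- by apply/measurable_funTS; exact: measurable_Px_X.
exists (Y @^-1` N); split; [exact: mYb|exact: PN|].
move=> w /= ngw; apply: gN => /= gw; apply: ngw => _; exact: gw.
Qed.

(** * Null-set modifications of augmented events and variables *)

Lemma filtration_oo_approx A : filtration_oo P X A ->
  exists A' N, [/\ G A', G N, P N = 0 & A `\` N = A' `\` N].
Proof.
move=> FA; apply: completion_approx; first by move=> t /=; rewrite in_itv/=
  andbT.
move: A FA; apply: smallest_sub; first exact: smallest_sigma_algebra.
move=> A [t /=]; rewrite in_itv/= andbT => t0 FA.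
have := FA (t + 1)%R; rewrite /= in_itv/= andbT ltrDl => /(_ ltr01).
apply: sub_sigma_algebra2; apply: setSU.
apply: sub_sigma_gen => s /=; rewrite !in_itv/= andbT => /andP[//].
Qed.

(** The countably many level sets {Z < q}, with q rational, determine [Z]; off the union of their
    exceptional sets they can be replaced by events of the raw sigma-algebra. *)
Lemma filtration_oo_approx_fun (Z : Omega -> R) :
  measurable_wrt (filtration_oo P X) Z ->
  exists N, [/\ G N, P N = 0 &
    measurable_fun setT ((fun w => if w \in N then 0%R else Z w) : GOmega ->
      R)].
Proof.
(* [q] enumerates the rationals; a code of no rational gets the harmless value 0. *)
move=> mZ; pose q n : R := ratr (odflt 0%R (unpickle n)).
have qK r : q (pickle r) = ratr r by rewrite /q pickleK.
have qP n := filtration_oo_approx _ (mZ `]-oo, q n[%classic (measurable_itv _)).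
have [A' /choice[N AN]] := choice qP.
pose M := \bigcup_n N n.
have GN n : G (N n) by have [] := AN n.
have GM : G M by exact: sigma_algebra_bigcup.
exists M; split=> //.
  have mN n : measurable (N n) by exact: G_measurable.
  apply/negligibleP; first exact: bigcup_measurable.
  by apply: negligible_bigcup => n; apply/negligibleP => //; have [] := AN n.
have GD A B : G A -> G B -> G (A `\` B).
  by move=> GA GB; rewrite setDE; apply: G_setI => //; exact: sigma_algebraC.
have GU A B : G A -> G B -> G (A `|` B).
  by rewrite -!measurable_GE; exact: measurableU.
apply: (measurability (@RGenInftyO.G R)) => //;
  first exact: RGenInftyO.measurableE.
move=> _ [_ [x ->] <-]; rewrite setTI measurable_GE.
(* Z < x holds exactly when Z < q for some rational q <= x. On [M] the modified variable is 0, so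
   [M] belongs to the level set exactly when x > 0. *)
have -> : (fun w => if w \in M then 0%R else Z w) @^-1` `]-oo, x[%classic =
    (\bigcup_(n in [set n | q n <= x]%R) A' n) `\` M `|`
      (if (0 < x)%R then M else set0).
  apply/seteqP; split => w /=; rewrite in_itv/=.
    case: ifPn => [wM x0|wM Zx]; first by rewrite x0; right; rewrite inE in wM.
    left; split; last by move=> Mw; rewrite mem_set in wM.
    have [r] := rat_in_itvoo Zx; rewrite in_itv/= => /andP[Zr rx].
    exists (pickle r); first by rewrite /= qK ltW.
    have [_ _ _ AE] := AN (pickle r).
    suff [] : (A' (pickle r) `\` N (pickle r)) w by [].
    rewrite -AE; split; first by rewrite /= in_itv qK.
    by move=> Nw; move: wM; rewrite mem_set//; exists (pickle r).
  case=> [[[n /= qx A'w] nMw]|].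
    rewrite memNset//; have [_ _ _ AE] := AN n.
    have [] : (Z @^-1` `]-oo, q n[%classic `\` N n) w.
      by rewrite AE; split => // Nw; apply: nMw; exists n.
    by rewrite /= in_itv/= => Zq _; rewrite (lt_le_trans Zq).
  by case: ifPn => // x0 Mw; rewrite mem_set.
apply: GU; last by case: ifP => // _; exact: sigma_algebra0.
apply: GD => //; rewrite -measurable_GE; apply: bigcup_measurable => n _.
by rewrite measurable_GE; have [] := AN n.
Qed.

Lemma markov_at_of_markov_process : markov_process P X Px ->
  forall t A B, (0 <= t)%R -> past t A -> G B -> markov_at A t B.
Proof.
move=> markov; apply: markov_at_future => s r b A s0 r0 mb HA.
have mA := past_measurable _ HA.
have ssr : (s <= s + r)%R by rewrite lerDl.
have [_ /(_ A (past_filtration _ _ HA))] := markov s (s + r)%R s0 ssr b mb.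
rewrite /markov_at addrAC subrr add0r => ->; rewrite shift_evt// setIC.
by rewrite integral_indic//; apply: measurable_evt => //; exact: addr_ge0.
Qed.

(** * From the Markov property to the shift property *)

Section from_markov.
Hypothesis markov : forall t A B, (0 <= t)%R -> past t A -> G B ->
  markov_at A t B.

(** The Markov property with the sure event as past, combined with FOED. *)
Lemma shift_measure t B : (0 <= t)%R -> G B ->
  P (theta t @^-1` B) = \int[P]_(w in B) e t (X 0 w).
Proof.
move=> t0 GB; have := regular_evolution_integral t B setT t0 GB measurableT.
rewrite !preimage_setT setIT => <-.
have HT : past t setT by rewrite -setC0; apply: sigma_algebraC;
  exact: sigma_algebra0.
by have := markov t setT B t0 HT GB; rewrite /markov_at setTI.
Qed.

(** By [shift_measure] the law of the shift has a density on the raw sigma-algebra, so it cannot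
    charge a null event. A variable may therefore be modified on such an event before it is
    shifted. *)
Lemma shift_null t N : (0 <= t)%R -> G N -> P N = 0 -> P (theta t @^-1` N) = 0.
Proof.
move=> t0 GN PN; rewrite shift_measure//.
have mev : measurable_fun setT (fun w => e t (X 0 w)).
  by apply: measurableT_comp (measurable_exp_evolution t) _; exact: mX.
have mN := G_measurable _ GN.
rewrite (ge0_negligible_integral mN mN)//; first by rewrite setDv integral_set0.
  exact: measurable_funTS.
by move=> w _; exact: exp_evolution_ge0.
Qed.

Lemma shift_integral t (Z : Omega -> \bar R) : (0 <= t)%R ->
  measurable_fun setT (Z : GOmega -> \bar R) -> (forall w, 0 <= Z w) ->
  \int[P]_w Z (theta t w) = \int[P]_w (Z w * e t (X 0 w)).
Proof.
move=> t0 mZ Z0.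
apply: (@eq_measure_integral_comp _ _ _ GOmega P setT setT
  (fun w => e t (X 0 w)) (theta t) id Z) => //.
- by apply: measurableT_comp (measurable_exp_evolution t) _; exact: mX.
- by move=> w; exact: exp_evolution_ge0.
- exact: measurable_shift.
- exact: measurable_idG.
- move=> B; rewrite measurable_GE => GB.
  by rewrite !setTI preimage_id; exact: shift_measure.
Qed.

(* Given X_t, the past and the future are independent: a version of
   E(Z o theta_t | X_t) integrates correctly over every past event. *)
Lemma shift_integral_past t A (Z : Omega -> \bar R) (h : borel E -> \bar R) :
  (0 <= t)%R -> past t A ->
  measurable_fun setT (Z : GOmega -> \bar R) -> (forall w, 0 <= Z w) ->
  measurable_fun setT h -> (forall x, 0 <= h x) ->
  (forall b, measurable b ->
    \int[P]_(w in evt t b) h (X t w) = \int[P]_(w in evt t b) Z (theta t w)) ->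
  \int[P]_(w in A) h (X t w) = \int[P]_(w in A) Z (theta t w).
Proof.
move=> t0 HA mZ Z0 mh h0 hZ; have mA := past_measurable _ HA.
have mXt : measurable_fun setT (X t : Omega -> borel E) by exact: mX.
have [psi [mpsi psi0 psiE]] := density_along P _ _ mXt mA.
have mpsiX : measurable_fun setT (fun w => psi (X t w)) by exact:
  measurableT_comp mpsi mXt.
have mZt : measurable_fun setT (fun w => Z (theta t w)).
  exact: measurableT_comp mZ (measurable_shift _ t0).
have mhX : measurable_fun setT (fun w => h (X t w)) by exact: measurableT_comp
  mh mXt.
have PA B : G B -> P (A `&` theta t @^-1` B) =
    \int[P]_(w in theta t @^-1` B) psi (X t w).
  move=> GB; rewrite (markov t A B t0 HA GB).
  have mPxt : measurable_fun setT (fun w => Px (X t w) B) by exact: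
    measurable_Px_X.
  have mtB : measurable (theta t @^-1` B) by apply: G_measurable;
    exact: G_shift.
  rewrite (@eq_measure_integral_comp _ _ _ (borel E) P A setT
    (fun w => psi (X t w)) (X t) (X t) (fun x => Px x B))//; last 2 first.
  - exact: measurable_Px.
  - by move=> b mb; rewrite setTI psiE.
  under eq_integral do rewrite muleC.
  apply/esym/(@eq_measure_integral_comp _ _ _ (borel E) P (theta t @^-1` B) setT
    (fun w => Px (X t w) B) (X t) (X t) psi) => //.
  move=> b mb; rewrite setTI setIC; apply: markov => //.
  by apply: past_evt.
rewrite (@eq_measure_integral_comp _ _ _ (borel E) P A setT
    (fun w => psi (X t w)) (X t) (X t) h)//; last first.
  by move=> b mb; rewrite setTI psiE.
rewrite (@eq_measure_integral_comp _ _ _ GOmega P A setT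
    (fun w => psi (X t w)) (theta t) (theta t) Z)//; last 3 first.
- exact: measurable_shift.
- exact: measurable_shift.
- by move=> B; rewrite measurable_GE => GB; rewrite setTI PA.
under eq_integral do rewrite muleC; under [RHS]eq_integral do rewrite muleC.
apply: (@eq_integral_comp _ _ _ _ _ _ (borel E) P P setT setT) => //.
by move=> b mb; rewrite !setTI hZ.
Qed.

(** Measurability of [g] comes from the completeness of [P], since [g] is only known to agree with
    [f] almost everywhere. *)
Lemma integral_eq_off_null (f g : Omega -> \bar R) N D :
  measurable_fun setT f -> measurable N -> P N = 0 ->
  (forall w, ~ N w -> f w = g w) -> measurable D ->
  measurable_fun setT g /\ \int[P]_(w in D) f w = \int[P]_(w in D) g w.
Proof.
move=> mf mN PN fg mD.
have fgT : ae_eq P setT f g.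
  by exists N; split => // w /= nfg; apply: contrapT => /fg fgw; exact: nfg.
have mg : measurable_fun setT g by exact: ae_measurable_fun fgT mf.
split => //; apply: ae_eq_integral => //; try exact: measurable_funTS.
by apply: ae_eq_subset fgT.
Qed.

(** [Z'] is [Z] set to 0 on a null event of the raw sigma-algebra, whose preimage under the shift is
    null too. Its values being 0 or those of [Z], it inherits nonnegativity. *)
Lemma shift_approx t (Z : Omega -> R) : (0 <= t)%R ->
  measurable_wrt (filtration_oo P X) Z ->
  exists Z' : Omega -> R, [/\ measurable_fun setT (Z' : GOmega -> R),
    (forall w, Z' w = 0%R \/ Z' w = Z w),
    measurable_fun setT (fun w => Z (theta t w)),
    forall D, measurable D ->
      \int[P]_(w in D) (Z (theta t w))%:E =
        \int[P]_(w in D) (Z' (theta t w))%:E &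
    \int[P]_w (Z w * exp_evolution F t (X 0 w))%:E =
    \int[P]_w (Z' w * exp_evolution F t (X 0 w))%:E].
Proof.
move=> t0 mZ; have [N [GN PN mZ']] := filtration_oo_approx_fun Z mZ.
pose Z' w := if w \in N then 0%R else Z w.
have mN := G_measurable _ GN.
have Z'E w : ~ N w -> Z' w = Z w by move=> nN; rewrite /Z' memNset.
have mZ't : measurable_fun setT (fun w => (Z' (theta t w))%:E).
  by apply/measurable_EFinP; exact: measurableT_comp mZ' (measurable_shift _
    t0).
have mtN : measurable (theta t @^-1` N) by apply: G_measurable; exact: G_shift.
have off w : ~ (theta t @^-1` N) w -> (Z' (theta t w))%:E = (Z (theta t w))%:E.
  by move=> nN; rewrite Z'E.
have ZtE D := integral_eq_off_null _ _ _ D mZ't mtN (shift_null t N t0 GN PN)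
  off.
exists Z'; split => //.
- by move=> w; rewrite /Z'; case: ifP; [left|right].
- by apply/measurable_EFinP; have [] := ZtE setT measurableT.
- by move=> D /ZtE[].
- have mZ'e : measurable_fun setT (fun w => (Z' w * exp_evolution F t (X 0
  w))%:E).
    apply/measurable_EFinP; apply: measurable_funM.
      exact: measurableT_comp mZ' measurable_idG.
    apply/measurable_EFinP.
    by apply: measurableT_comp (measurable_exp_evolution t) _; exact: mX.
  have [|//] := integral_eq_off_null _ (fun w => (Z w * exp_evolution F t (X 0
    w))%:E)
    _ setT mZ'e mN PN _ measurableT.
  by move=> w nN; rewrite Z'E.
Qed.

Lemma shift_expectation t (Z : Omega -> R) : (0 <= t)%R ->
  measurable_wrt (filtration_oo P X) Z ->
  'E_P[fun w => Z (theta t w)] =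
  'E_P[fun w => (Z w * exp_evolution F t (X 0 w))%R].
Proof.
move=> t0 mZ; rewrite !expectationE.
have [Z' [mZ' _ _ ZE ->]] := shift_approx t Z t0 mZ; rewrite ZE//.
have mEZ' : measurable_fun setT (EFin \o (Z' : GOmega ->
  R)) by exact/measurable_EFinP.
(* No integrability is available, so the positive and negative parts are transported separately; the
   nonnegative weight commutes with taking them. *)
rewrite [LHS]integralE [RHS]integralE; congr (_ - _).
- transitivity (\int[P]_w (EFin \o Z')^\+ (theta t w)).
    by apply: eq_integral => w _; rewrite !funeposE.
  rewrite (shift_integral t (EFin \o Z')^\+)//; last exact: measurable_funepos.
  apply: eq_integral => w _.
  by rewrite !funeposE/= EFinM maxe_pMl ?mul0e// exp_evolution_ge0.
- transitivity (\int[P]_w (EFin \o Z')^\- (theta t w)).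
    by apply: eq_integral => w _; rewrite !funenegE.
  rewrite (shift_integral t (EFin \o Z')^\-)//; last exact: measurable_funeneg.
  apply: eq_integral => w _.
  by rewrite !funenegE EFinM -mulNe maxe_pMl ?mul0e// exp_evolution_ge0.
Qed.

Lemma integral_pushforwardE d (S : measurableType d) (Y : Omega -> S)
    (g : S -> \bar R) b : measurable_fun setT Y -> measurable_fun setT g ->
      measurable b ->
  \int[pushforward P Y]_(y in b) g y = \int[P]_(w in Y @^-1` b) g (Y w).
Proof.
move=> mY mg mb; rewrite [LHS]integralE [RHS]integralE.
rewrite !ge0_integral_pushforward//.
- by congr (_ - _); apply: eq_integral => w _; rewrite /= ?funeposE ?funenegE.
- by apply/measurable_funTS/measurable_funeneg.
- by apply/measurable_funTS/measurable_funepos.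
Qed.

(** By [shift_integral_past], [h] of the first coordinate is itself a version given the pair,
    because an event on (X_t, X_0) belongs to the past of [t]. Uniqueness of versions concludes. *)
Lemma shift_conditional_ge0 t (Z : Omega -> R) g (h : borel E ->
  \bar R) : (0 <= t)%R ->
  measurable_wrt (filtration_oo P X) Z -> (forall w, 0 <= Z w)%R ->
  is_cond_exp_given P (fun w => (X t w, X 0 w) : (borel E * borel E)%type)
    (fun w => (Z (theta t w))%:E) g ->
  is_cond_exp_given P (X t : Omega ->
    borel E) (fun w => (Z (theta t w))%:E) h ->
  {ae pushforward P (fun w => (X t w, X 0 w) : (borel E * borel E)%type),
    forall xy, g xy = h xy.1}.
Proof.
move=> t0 mZ Z0 [mg [_ gE]] [mh [_ hE]].
have mXt : measurable_fun setT (X t : Omega -> borel E) by exact: mX.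
pose Y w : borel E * borel E := (X t w, X 0 w).
have mY : measurable_fun setT Y by apply: measurable_fun_pair; exact: mX.
have mYb b : measurable b -> measurable (Y @^-1` b).
  by move=> mb; rewrite -[X in measurable X]setTI; apply: mY.
pose lawY : {finite_measure set (borel E * borel E)%type -> \bar R} :=
  distribution P (HB.pack_for {mfun Omega >-> (borel E * borel E)%type} Y
    (isMeasurableFun.Build _ _ _ _ _ mY)).
pose lawX : {finite_measure set (borel E) -> \bar R} :=
  distribution P (HB.pack_for {mfun Omega >-> borel E} (X t : Omega -> borel E)
    (isMeasurableFun.Build _ _ _ _ _ mXt)).
have gYE b : measurable b ->
    \int[P]_(w in Y @^-1` b) g (Y w) =
      \int[P]_(w in Y @^-1` b) (Z (theta t w))%:E.
  by move=> mb; apply: gE; exists b => //; rewrite setTI.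
have hXE b : measurable b ->
    \int[P]_(w in evt t b) h (X t w) =
      \int[P]_(w in evt t b) (Z (theta t w))%:E.
  by move=> mb; apply: hE; exists b => //; rewrite setTI.
have Wge0 D : 0 <= \int[P]_(w in D) (Z (theta t w))%:E.
  by apply: integral_ge0 => w _; rewrite lee_fin.
have [N [mN PN hN]] : {ae lawX, forall x, 0 <= h x}.
  apply: ae_ge0_of_integral => // b mb.
  by rewrite [leRHS](@integral_pushforwardE _ (borel E) (X t))// hXE.
(* [h] is nonnegative only almost everywhere for the law of X_t, whereas [shift_integral_past] asks
   for it everywhere; [h^\+] replaces it. *)
have mhp : measurable_fun setT (h^\+) by exact: measurable_funepos.
have hposE D : measurable D ->
    \int[P]_(w in D) h (X t w) = \int[P]_(w in D) h^\+ (X t w).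
  move=> mD; have mtN : measurable (evt t N) by exact: measurable_evt.
  have [|//] := integral_eq_off_null (fun w => h (X t w)) (fun w => h^\+ (X t
    w)) _ D
    (measurableT_comp mh mXt) mtN PN _ mD.
  move=> w nN; rewrite funeposE; apply/esym/max_idPl.
  by apply: contrapT => /hN.
have [Z' [mZ' Z'Z mZt ZE _]] := shift_approx t Z t0 mZ.
have hYE b : measurable b ->
    \int[P]_(w in Y @^-1` b) h (X t w) =
      \int[P]_(w in Y @^-1` b) (Z (theta t w))%:E.
  move=> mb; rewrite ZE ?hposE; [|exact: mYb|exact: mYb].
  apply: (shift_integral_past t (Y @^-1` b) (EFin \o Z')) => //.
  - pose PT := g_sigma_algebraType (past t).
    have PTE (B : set PT) : measurable B = past t B.
      by rewrite /measurable/= sigma_algebra_id//;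
        exact: smallest_sigma_algebra.
    have mYt : measurable_fun setT (Y : PT -> (borel E * borel E)%type).
      by apply: measurable_fun_pair => _ c mc; rewrite setTI PTE;
        exact: past_evt.
    by have := mYt measurableT b mb; rewrite PTE setTI.
  - exact/measurable_EFinP.
  - by move=> w /=; rewrite lee_fin; case: (Z'Z w) => ->.
  - move=> c mc; rewrite -hposE ?hXE ?ZE//; exact: measurable_evt.
apply: (ae_eq_of_integral lawY g (fun xy => h xy.1)) => //.
- exact: measurableT_comp mh _.
- move=> b mb; rewrite [leRHS](@integral_pushforwardE _ (borel E * borel
  E)%type Y)// gYE//.
- move=> b mb; rewrite [LHS](@integral_pushforwardE _ (borel E * borel E)%type
  Y)// gYE//.
  rewrite [RHS](@integral_pushforwardE _ (borel E * borel E)%type Y (fun xy =>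
    h xy.1))// ?hYE//.
  exact: measurableT_comp mh _.
Qed.
(** This reduces bounded variables to nonnegative ones. *)
Lemma is_cond_exp_given_addr d (S : measurableType d) (Y : Omega -> S)
    (W : Omega -> R) (c : R) (g : S -> \bar R) :
  measurable_fun setT Y -> measurable_fun setT W -> (exists M, forall w,
    `|W w| <= M)%R ->
  is_cond_exp_given P Y (fun w => (W w)%:E) g ->
  is_cond_exp_given P Y (fun w => (W w + c)%:E) (fun y => g y + c%:E).
Proof.
move=> mY mW [M WM] [mg [_ gE]].
have mYb b : measurable b -> measurable (Y @^-1` b).
  by move=> mb; rewrite -[X in measurable X]setTI; apply: mY.
have mgY : measurable_fun setT (g \o Y) by exact: measurableT_comp mg mY.
have mgc : measurable_fun setT (fun y => g y + c%:E) by apply: emeasurable_funD.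
have intW : P.-integrable setT (EFin \o W).
  apply: (@le_integrable _ _ _ P _ measurableT _ (cst M%:E)) => //.
  - exact/measurable_EFinP.
  - by move=> w _ /=; rewrite lee_fin (le_trans (WM w))// ler_norm.
  - exact: finite_measure_integrable_cst.
have finI D : measurable D -> \int[P]_(w in D) (W w)%:E \is a fin_num.
  by move=> mD; apply: integrable_fin_num => //; exact: integrableS intW.
have gYE b : measurable b ->
    \int[P]_(w in Y @^-1` b) g (Y w) = \int[P]_(w in Y @^-1` b) (W w)%:E.
  by move=> mb; apply: gE; exists b => //; rewrite setTI.
(* Integrability of a version has to be derived: testing on the two sign sets of [g] expresses the
   integral of |g(Y)| through integrals of the bounded [W]. *)
have intg : P.-integrable setT (g \o Y).
  apply/integrableP; split => //.
  pose b := [set y | 0 <= g y].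
  have mb : measurable b.
    by rewrite -[X in measurable X]setTI; exact: emeasurable_fun_c_infty.
  have mnb : measurable (~` b) by exact: measurableC.
  have mYB : measurable (Y @^-1` b) by exact: mYb.
  have mYC : measurable (Y @^-1` (~` b)) by exact: mYb.
  rewrite -(setUv (Y @^-1` b)) ge0_integral_setU//; last 2 first.
  - by rewrite setUv; exact: measurableT_comp.
  - by rewrite disj_set2E setICr.
  rewrite (_ : \int[P]_(x in Y @^-1` b) `|(g \o Y) x| =
    \int[P]_(w in Y @^-1` b) (W w)%:E); last first.
    by rewrite -gYE//; apply: eq_integral => w; rewrite inE => bw;
      rewrite gee0_abs.
  rewrite (_ : \int[P]_(x in ~` (Y @^-1` b)) `|(g \o Y) x| =
      - \int[P]_(w in Y @^-1` (~` b)) (W w)%:E); last first.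
    rewrite -gYE//; have lt0 w : ~ b (Y w) -> g (Y w) < 0 by move=> /negP;
      rewrite -ltNge.
    transitivity (\int[P]_(w in Y @^-1` (~` b)) - g (Y w)).
      by apply: eq_integral => w; rewrite inE => bw; rewrite lte0_abs//;
        exact: lt0.
    rewrite -[LHS]oppeK; congr (- _).
    rewrite -integral_ge0N; last by move=> w /lt0 gw; rewrite oppe_ge0 ltW.
    by apply: eq_integral => w _; rewrite oppeK.
  by rewrite -(fineK (finI _ mYB)) -(fineK (finI _ mYC)) -EFinN -EFinD ltry.
split => //; split.
  move=> C mC; exists ((fun y => g y + c%:E) @^-1` C); last by rewrite setTI.
  by rewrite -[X in measurable X]setTI; apply: mgc.
move=> _ [b mb <-]; rewrite setTI.
have mB := mYb b mb.
have intc : P.-integrable (Y @^-1` b) (cst c%:E) by exact: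
  finite_measure_integrable_cst.
rewrite (@integralD _ _ _ P _ mB (g \o Y) (cst c%:E))//;
  last exact: integrableS intg.
rewrite gYE//.
rewrite -(@integralD _ _ _ P _ mB (EFin \o W) (cst c%:E))//;
  exact: integrableS intW.
Qed.

Lemma shift_property_of_markov : shift_property P X theta F.
Proof.
move=> Z mZ Zcond t t0; have tge0 := ltW t0; split;
  first exact: shift_expectation.
move=> g h gW hW; case: Zcond => [Z0|[M ZM]].
  exact: (shift_conditional_ge0 t Z g h).
have [Z' [_ _ mZt _ _]] := shift_approx t Z tge0 mZ.
have bZt : (exists M, forall w, `|Z (theta t w)| <= M)%R by exists M => w;
  exact: ZM.
have mXt : measurable_fun setT (X t : Omega -> borel E) by exact: mX.
have mY : measurable_fun setT (fun w => (X t w,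
  X 0 w) : (borel E * borel E)%type).
  by apply: measurable_fun_pair; exact: mX.
(* With [M] a bound for |Z|, the variable Z + M is nonnegative, and the finite constant [M] cancels
   at the end. *)
have gM := is_cond_exp_given_addr _ _ _ _ M _ mY mZt bZt gW.
have hM := is_cond_exp_given_addr _ _ _ _ M _ mXt mZt bZt hW.
have mZM : measurable_wrt (filtration_oo P X) (fun w => Z w + M)%R.
  move=> C mC; apply: (mZ ((fun z : R => z + M)%R @^-1` C)).
  rewrite -[X in measurable X]setTI.
  by have /(_ measurableT C mC) : measurable_fun setT (fun z : R => z + M)%R by
    apply: measurable_funD.
have ZM0 w : (0 <= Z w + M)%R.
  by rewrite -lerBlDr sub0r; have := ZM w; rewrite ler_norml => /andP[].
have [N [mN PN gN]] := shift_conditional_ge0 t _ _ _ tge0 mZM ZM0 gM hM.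
exists N; split => // xy /= ngh; apply: gN => /= eqM; apply: ngh.
by have /(congr1 (fun z => z - M%:E)) := eqM; rewrite !addeK.
Qed.

End from_markov.

Lemma shift_property_iff_markov : shift_property P X theta F <->
  markov_process P X Px.
Proof.
split=> [shiftP|markov].
  apply: markov_process_of_markov_at; apply: markov_at_cylinder.
  exact: markov_at_pair_of_shift_property.
exact/shift_property_of_markov/markov_at_of_markov_process.
Qed.

End process_facts.

Theorem theorem2p6 (R : realType)
    (dO : measure_display) (Omega : measurableType dO) (P : probability Omega R)
    (complete_P : measure_is_complete P)
    (E : ptopologicalType) (polish_E : polish R E)
    (d : nat) (iota : E -> 'rV[R]_d) (iota_emb : topological_embedding iota)
    (X : R -> Omega -> E)
    (mX : forall t, 0 <= t -> measurable_fun setT (X t : Omega -> borel E))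
    (cadlag_X : cadlag X)
    (theta : R -> Omega -> Omega) (theta_X : shift_operators X theta)
    (Px : R.-pker (borel E) ~> g_sigma_algebraType (sigma_gen X `[0, +oo[))
    (Px_X : regular_cond_prob P X Px)
    (atomless_X0 : atomless (pushforward P (X 0 : Omega -> borel E)))
    (density_X0 : has_positive_density P X iota)
    (F : R -> E -> R) (foed_X : FOED P X F) :
  shift_property P X theta F <-> markov_process P X Px.
Proof. exact: shift_property_iff_markov. Qed.
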